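(* Let $(X,d)$ be a $\delta$-hyperbolic space and $a,b$ isometries of hyperbolic type such that $\langle a,b\rangle$ is a discrete, not virtually cyclic subgroup of $\operatorname{Isom}(X,d)$. Assume $L(a,b)>23\delta$. Then: (i) if $\ell(a),\ell(b)\le13\delta$, the subgroup generated by $\{a,b\}$ is free (freely generated by $a,b$); (ii) if $\ell(a),\ell(b)>13\delta$, one of the semigroups generated by $\{a,b\}$ or $\{a,b^{-1}\}$ is free; (iii) if $\ell(a)\le13\delta$ and $\ell(b)>13\delta$, one of the semigroups generated by $\{b,aba^{-1}\}$ or $\{b,ab^{-1}a^{-1}\}$ is free; (iv) if $\ell(a)>13\delta$ and $\ell(b)\le13\delta$, one of the semigroups generated by $\{a,bab^{-1}\}$ or $\{a,ba^{-1}b^{-1}\}$ is free.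
   Context: $L(a,b)$ (Margulis constant of the pair) is the infimum of $\max[d(x,a^px),d(x,b^qx)]$ over $x\in X$ and $(p,q)\in\mathbb Z^*\times\mathbb Z^*$ with $a^p,b^q$ nontrivial. $\ell(g)=\lim_k\frac1kd(x,g^kx)$; hyperbolic type means $\ell(g)>0$. $\delta$-hyperbolic: geodesic, proper, all geodesic triangles $\delta$-thin in the tripod sense (Gromov products $(y|z)_x=\frac12(d(x,y)+d(x,z)-d(y,z))$). Discrete: for the topology of uniform convergence on compacts. A semigroup generated by $\{u,v\}$ is free if distinct nonempty positive words in $u,v$ give distinct elements. *)

(* Defs.v *)
From Stdlib Require Import Reals List ZArith.
Open Scope R_scope.

Section Defs.
Context {X : Type} (d : X -> X -> R).

Definition is_metric : Prop :=
  (forall x y, 0 <= d x y) /\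
  (forall x y, d x y = 0 <-> x = y) /\
  (forall x y, d x y = d y x) /\
  (forall x y z, d x z <= d x y + d y z).

Definition open_set (U : X -> Prop) : Prop :=
  forall y, U y -> exists e, 0 < e /\ forall z, d y z < e -> U z.

Definition compact_set (K : X -> Prop) : Prop :=
  forall (I : Type) (U : I -> X -> Prop),
    (forall i, open_set (U i)) ->
    (forall y, K y -> exists i, U i y) ->
    exists l : list I, forall y, K y -> exists i, In i l /\ U i y.

Definition closed_ball (x : X) (r : R) : X -> Prop := fun y => d x y <= r.

Definition proper_space : Prop := forall x r, compact_set (closed_ball x r).

Definition geodesic_seg (x y : X) (g : R -> X) : Prop :=
  g 0 = x /\ g (d x y) = y /\
  forall s t, 0 <= s <= d x y -> 0 <= t <= d x y -> d (g s) (g t) = Rabs (s - t).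

Definition geodesic_space : Prop :=
  forall x y, exists g, geodesic_seg x y g.

Definition gromov (x y z : X) : R := (d x y + d x z - d y z) / 2.

(** Every geodesic triangle with sides gxy, gxz, gyz is delta-thin in the
    tripod sense: points on two sides issuing from a common vertex v at the
    same distance t <= (Gromov product at v) from v are delta-close. *)
Definition thin_triangles (delta : R) : Prop :=
  forall x y z gxy gxz gyz,
    geodesic_seg x y gxy -> geodesic_seg x z gxz -> geodesic_seg y z gyz ->
    (forall t, 0 <= t <= gromov x y z -> d (gxy t) (gxz t) <= delta) /\
    (forall t, 0 <= t <= gromov y x z ->
        d (gxy (d x y - t)) (gyz t) <= delta) /\
    (forall t, 0 <= t <= gromov z x y ->
        d (gxz (d x z - t)) (gyz (d y z - t)) <= delta).

Definition hyperbolic_space (delta : R) : Prop :=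
  is_metric /\ geodesic_space /\ proper_space /\ thin_triangles delta.

Definition isometry_with_inv (f finv : X -> X) : Prop :=
  (forall x y, d (f x) (f y) = d x y) /\
  (forall x, f (finv x) = x) /\ (forall x, finv (f x) = x).

Definition transl_length (g : X -> X) (l : R) : Prop :=
  forall x, Un_cv (fun n => d x (Nat.iter (S n) g x) / INR (S n)) l.

Definition zpow (f finv : X -> X) (p : Z) : X -> X :=
  match p with
  | Z0 => fun x => x
  | Zpos n => Nat.iter (Pos.to_nat n) f
  | Zneg n => Nat.iter (Pos.to_nat n) finv
  end.

Definition nontrivial (f : X -> X) : Prop := exists x, f x <> x.

Definition margulis_set (a ainv b binv : X -> X) (m : R) : Prop :=
  exists x p q, p <> 0%Z /\ q <> 0%Z /\
    nontrivial (zpow a ainv p) /\ nontrivial (zpow b binv q) /\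
    m = Rmax (d x (zpow a ainv p x)) (d x (zpow b binv q x)).

Definition is_inf (S : R -> Prop) (L : R) : Prop :=
  (forall m, S m -> L <= m) /\
  (forall L', (forall m, S m -> L' <= m) -> L' <= L).

Definition margulis_const (a ainv b binv : X -> X) (L : R) : Prop :=
  is_inf (margulis_set a ainv b binv) L.

Inductive gen := Ga | Gb.
Definition letter := (gen * bool)%type.

Definition eval_letter (a ainv b binv : X -> X) (l : letter) : X -> X :=
  match l with
  | (Ga, false) => a | (Ga, true) => ainv
  | (Gb, false) => b | (Gb, true) => binv
  end.

Fixpoint eval_word (a ainv b binv : X -> X) (w : list letter) : X -> X :=
  match w with
  | nil => fun x => x
  | l :: w' => fun x => eval_letter a ainv b binv l (eval_word a ainv b binv w' x)
  end.

Definition inv_letter (l : letter) : letter := (fst l, negb (snd l)).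
Definition inv_word (w : list letter) : list letter := rev (map inv_letter w).

Fixpoint rep_word (n : nat) (w : list letter) : list letter :=
  match n with O => nil | S k => w ++ rep_word k w end.

Definition zpow_word (w : list letter) (n : Z) : list letter :=
  match n with
  | Z0 => nil
  | Zpos k => rep_word (Pos.to_nat k) w
  | Zneg k => rep_word (Pos.to_nat k) (inv_word w)
  end.

Definition ext_eq (f g : X -> X) : Prop := forall x, f x = g x.

(** Discreteness of <a,b> in Isom(X) for the topology of uniform convergence
    on compacts: each element g is isolated, i.e. has a basic neighbourhood
    {h : forall x in K, d(h x, g x) < eps} (K compact, eps > 0) meeting the
    subgroup only in g. *)
Definition discrete_subgroup (a ainv b binv : X -> X) : Prop :=
  forall g : list letter, exists K eps, compact_set K /\ 0 < eps /\
    forall h : list letter,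
      (forall x, K x -> d (eval_word a ainv b binv h x) (eval_word a ainv b binv g x) < eps) ->
      ext_eq (eval_word a ainv b binv h) (eval_word a ainv b binv g).

(** Virtually cyclic: some cyclic subgroup <c> has finite index, i.e.
    finitely many cosets g_i <c> cover <a,b>. *)
Definition virtually_cyclic (a ainv b binv : X -> X) : Prop :=
  exists (c : list letter) (gs : list (list letter)),
    forall w : list letter, exists g n, In g gs /\
      ext_eq (eval_word a ainv b binv w)
             (eval_word a ainv b binv (g ++ zpow_word c n)).

Fixpoint reduced (w : list letter) : Prop :=
  match w with
  | l1 :: ((l2 :: _) as w') => l2 <> inv_letter l1 /\ reduced w'
  | _ => True
  end.

Definition free_group_on (a ainv b binv : X -> X) : Prop :=
  forall w, w <> nil -> reduced w -> nontrivial (eval_word a ainv b binv w).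

Fixpoint eval_pos (u v : X -> X) (w : list bool) : X -> X :=
  match w with
  | nil => fun x => x
  | c :: w' => fun x => (if c then v else u) (eval_pos u v w' x)
  end.

Definition free_semigroup (u v : X -> X) : Prop :=
  forall w1 w2 : list bool, w1 <> nil -> w2 <> nil -> w1 <> w2 ->
    ~ ext_eq (eval_pos u v w1) (eval_pos u v w2).

End Defs.

(* Main.v *)
(** Everything rests on the four-point inequality. For a hyperbolic isometry g put
    s_k = d(x, g^k x) and l = l(g); comparing x with far points of its orbit gives
    s_{n+p} <= max(s_n, s_p + n l) + 2 delta, s_{n-p} <= max(s_n, s_p) + 2 delta, and
    s_2 >= s_1 + l - 2 delta when l > delta.

    (i) Take x almost realizing L(a,b). By the estimates above, moving x by 5/2 delta towards
    a^p x brings the displacement by some power of a below L - 2 delta, and likewise for b.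
    If some [x, a^p x] and [x, b^q x] stayed close for that long, one point would contradict
    the definition of L. So all products (a^p x | b^q x)_x are at most 5/2 delta while all
    displacements are at least 15/2 delta, and ping-pong on syllables applies.

    (ii) Properness and discreteness leave finitely many elements moving o by at most C. Hence
    if no nontrivial powers of a and b agree, the orbits of a and b diverge in all directions,
    and at the center of the triangle a^-N o, a^N o, b^N o (N large, b replaced by its inverse
    if necessary) the products (a^-1 x | b x)_x, (b^-1 x | a x)_x and (a x | b x)_x are at most
    4 delta: positive words are then local quasi-geodesics. If a^p = b^q, this element is
    central, every point of the orbit has the same displacement under its powers as o, hence is
    close to its orbit, and the group is virtually cyclic.

    (iii), (iv) Apply this to b and a b a^-1: if b^p and a b^q a^-1 agree, then |p| = |q| and
    conjugation by a maps b^p to itself or its inverse, which again forces virtual cyclicity. *)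

Require Import Defs.
From Stdlib Require Import Reals List ZArith Lra Lia Classical.
Open Scope R_scope.

Section Hyperbolic.
Context {X : Type} (d : X -> X -> R) (delta : R).
Context (HX : hyperbolic_space d delta).

(** * Gromov products, the four-point inequality and tripods *)

Lemma d_nonneg x y : 0 <= d x y.
Proof. destruct HX as [(H & _) _]; apply H. Qed.

Lemma d_refl x : d x x = 0.
Proof. destruct HX as [(_ & H & _) _]; now apply H. Qed.

Lemma d_sym x y : d x y = d y x.
Proof. destruct HX as [(_ & _ & H & _) _]; apply H. Qed.

Lemma d_tri x y z : d x z <= d x y + d y z.
Proof. destruct HX as [(_ & _ & _ & H) _]; apply H. Qed.

Lemma geodesic_point x y g t :
  geodesic_seg d x y g -> 0 <= t <= d x y ->
  d x (g t) = t /\ d (g t) y = d x y - t.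
Proof.
  intros (H0 & H1 & H) Ht.
  split.
  - rewrite <- H0 at 1. rewrite H by lra. rewrite Rabs_left1; lra.
  - rewrite <- H1 at 1. rewrite H by lra. rewrite Rabs_left1; lra.
Qed.

Lemma gromov_bounds x y z :
  0 <= gromov d x y z <= d x y /\ gromov d x y z <= d x z.
Proof.
  unfold gromov. pose proof (d_tri y x z). pose proof (d_tri x y z).
  pose proof (d_tri x z y). rewrite (d_sym y x) in *. rewrite (d_sym z y) in *. lra.
Qed.

Lemma delta_nonneg (x : X) : 0 <= delta.
Proof.
  destruct HX as (_ & Hg & _ & Ht). destruct (Hg x x) as [g G].
  destruct (Ht x x x g g g G G G) as (H & _).
  pose proof (gromov_bounds x x x).
  specialize (H 0 ltac:(lra)). pose proof (d_nonneg (g 0) (g 0)). lra.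
Qed.

(** Up to the smaller of the two Gromov products at [w], the side from [w] to [y] stays
    [delta]-close to the sides to [x] and to [z]. Passing from [x] to [z] through the three points
    at that distance bounds [d x z]. *)
Lemma four_point x y z w :
  d x z + d y w <= d x y + d z w + 2 * delta \/
  d x z + d y w <= d y z + d x w + 2 * delta.
Proof.
  destruct HX as (_ & Hg & _ & Ht).
  destruct (Hg w x) as [gx Gx], (Hg w y) as [gy Gy], (Hg w z) as [gz Gz].
  destruct (Hg x y) as [gxy Gxy], (Hg y z) as [gyz Gyz].
  destruct (Ht w x y gx gy gxy Gx Gy Gxy) as (H1 & _).
  destruct (Ht w y z gy gz gyz Gy Gz Gyz) as (H2 & _).
  pose proof (gromov_bounds w x y) as B1. pose proof (gromov_bounds w y z) as B2.
  set (t := Rmin (gromov d w x y) (gromov d w y z)).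
  assert (T1 : t <= gromov d w x y) by apply Rmin_l.
  assert (T2 : t <= gromov d w y z) by apply Rmin_r.
  assert (T0 : 0 <= t) by (apply Rmin_glb; lra).
  specialize (H1 t ltac:(lra)). specialize (H2 t ltac:(lra)).
  destruct (geodesic_point w x gx t Gx ltac:(lra)) as [_ E1].
  destruct (geodesic_point w z gz t Gz ltac:(lra)) as [_ E2].
  pose proof (d_tri x (gx t) z). pose proof (d_tri (gx t) (gy t) z).
  pose proof (d_tri (gy t) (gz t) z). rewrite (d_sym x (gx t)) in *.
  assert (t = gromov d w x y \/ t = gromov d w y z) as [E|E]
    by (unfold t, Rmin; destruct Rle_dec; tauto);
    unfold gromov in E; rewrite (d_sym y w), ?(d_sym z w), ?(d_sym x w); [left|right]; lra.
Qed.

Lemma gromov_ineq w x y z :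
  gromov d w x z >= gromov d w x y - delta \/
  gromov d w x z >= gromov d w y z - delta.
Proof.
  unfold gromov. rewrite (d_sym w x), (d_sym w y), (d_sym w z).
  destruct (four_point x y z w); [left|right]; lra.
Qed.

Lemma gromov_sym w x y : gromov d w x y = gromov d w y x.
Proof. unfold gromov. rewrite (d_sym x y). lra. Qed.

Lemma gromov_swap x w y : gromov d x w y = d x w - gromov d w x y.
Proof. unfold gromov. rewrite (d_sym w x). lra. Qed.

Lemma gromov_diag w x : gromov d w x x = d w x.
Proof. unfold gromov. rewrite d_refl. lra. Qed.

Lemma gromov_base w x : gromov d w x w = 0.
Proof. unfold gromov. rewrite d_refl, (d_sym x w). lra. Qed.

Lemma gromov_lipschitz x w y z : gromov d w y z <= gromov d x y z + d x w.
Proof.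
  unfold gromov. pose proof (d_tri w x y). pose proof (d_tri w x z).
  rewrite (d_sym w x) in *. lra.
Qed.

(** In the comparison tripod the point at parameter [t] lies on the leg of [x] or on that of [y];
    the [delta]-close point on the corresponding side continues straight to [z]. *)
Lemma interpolation x y g t z :
  geodesic_seg d x y g -> 0 <= t <= d x y ->
  d (g t) z <= d x z - t + delta \/ d (g t) z <= d y z - (d x y - t) + delta.
Proof.
  intros G Ht. destruct HX as (_ & Hg & _ & Hthin).
  destruct (Hg x z) as [gxz Gxz], (Hg y z) as [gyz Gyz].
  destruct (Hthin x y z g gxz gyz G Gxz Gyz) as (H1 & H2 & _).
  pose proof (gromov_bounds x y z) as B1. pose proof (gromov_bounds y x z) as B2.
  rewrite (gromov_swap y x z) in *. rewrite (d_sym y x) in *.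
  destruct (Rle_or_lt t (gromov d x y z)) as [L|L].
  - left. specialize (H1 t ltac:(lra)).
    destruct (geodesic_point x z gxz t Gxz ltac:(lra)) as [_ E].
    pose proof (d_tri (g t) (gxz t) z). lra.
  - right. specialize (H2 (d x y - t) ltac:(lra)).
    replace (d x y - (d x y - t)) with t in H2 by lra.
    destruct (geodesic_point y z gyz (d x y - t) Gyz ltac:(lra)) as [_ E].
    pose proof (d_tri (g t) (gyz (d x y - t)) z). lra.
Qed.

(** The witness is the point of a geodesic from [p] to [q] at distance [gromov d p q s] from [p],
    where the two bounds of [interpolation] coincide. *)
Lemma tripod_center p q s :
  exists x, gromov d x p q = 0 /\ gromov d x q s <= delta /\ gromov d x p s <= delta.
Proof.
  pose proof HX as (_ & Hg & _). destruct (Hg p q) as [g G].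
  pose proof (gromov_bounds p q s) as B. exists (g (gromov d p q s)).
  destruct (geodesic_point p q g _ G (proj1 B)) as [E1 E2].
  pose proof (interpolation p q g _ s G (proj1 B)) as I.
  pose proof (delta_nonneg p).
  unfold gromov at 1 3 5. rewrite (d_sym (g _) p), E1, E2.
  set (m := g _) in *. unfold gromov in *. lra.
Qed.

(** * Isometries, their inverses and powers *)

Record isom : Type := Isom
  { fw :> X -> X; bw : X -> X; isomP : isometry_with_inv d fw bw }.

Lemma iso_d (g : isom) x y : d (g x) (g y) = d x y.
Proof. apply (isomP g). Qed.

Lemma fw_bw (g : isom) x : g (bw g x) = x.
Proof. apply (isomP g). Qed.

Lemma bw_fw (g : isom) x : bw g (g x) = x.
Proof. apply (isomP g). Qed.

Lemma bw_d (g : isom) x y : d (bw g x) (bw g y) = d x y.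
Proof. rewrite <- (iso_d g), !fw_bw; reflexivity. Qed.

Lemma d_bw (g : isom) x y : d x (bw g y) = d (g x) y.
Proof. rewrite <- (iso_d g), fw_bw; reflexivity. Qed.

Lemma fw_inj (g : isom) x y : g x = g y -> x = y.
Proof. intro E. rewrite <- (bw_fw g x), E. apply bw_fw. Qed.

Lemma inv_isometry (g : isom) : isometry_with_inv d (bw g) g.
Proof. repeat split; intros; [apply bw_d|apply bw_fw|apply fw_bw]. Qed.

Definition inv (g : isom) : isom := Isom (bw g) g (inv_isometry g).

Lemma comp_isometry (g h : isom) :
  isometry_with_inv d (fun x => g (h x)) (fun x => bw h (bw g x)).
Proof.
  repeat split; intros; [now rewrite !iso_d|now rewrite !fw_bw|now rewrite !bw_fw].
Qed.

Definition comp (g h : isom) : isom := Isom _ _ (comp_isometry g h).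

Lemma id_isometry : isometry_with_inv d (fun x => x) (fun x => x).
Proof. repeat split; intros; reflexivity. Qed.

Fixpoint pow (g : isom) (n : nat) : isom :=
  match n with O => Isom _ _ id_isometry | S k => comp g (pow g k) end.

Lemma gromov_iso (g : isom) x y z : gromov d (g x) (g y) (g z) = gromov d x y z.
Proof. unfold gromov. now rewrite !iso_d. Qed.

Lemma pow_iter (g : isom) n x : pow g n x = Nat.iter n g x.
Proof. induction n as [|n IH]; [reflexivity|simpl; now rewrite IH]. Qed.

Lemma pow_add (g : isom) m n x : pow g (m + n) x = pow g m (pow g n x).
Proof. induction m as [|m IH]; [reflexivity|simpl; now rewrite IH]. Qed.

Lemma pow_comm (g : isom) m n x : pow g m (pow g n x) = pow g n (pow g m x).
Proof. rewrite <- !pow_add. f_equal. f_equal. lia. Qed.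

Lemma pow_mul (g : isom) m n x : pow g (m * n) x = pow (pow g n) m x.
Proof. induction m as [|m IH]; [reflexivity|]. simpl. now rewrite pow_add, IH. Qed.

Lemma pow_inv (g : isom) n x : pow (inv g) n x = bw (pow g n) x.
Proof.
  revert x; induction n as [|n IH]; intro x; [reflexivity|].
  replace (S n) with (n + 1)%nat at 1 by lia. rewrite pow_add. simpl. apply IH.
Qed.

Lemma pow_ext (g h : isom) n x :
  (forall y, g y = h y) -> pow g n x = pow h n x.
Proof. intro E. induction n as [|n IH]; [reflexivity|]. simpl. now rewrite IH, E. Qed.

Lemma d_pow (g : isom) i j x :
  (i <= j)%nat -> d (pow g i x) (pow g j x) = d x (pow g (j - i) x).
Proof.
  intro L. replace j with (i + (j - i))%nat at 1 by lia. now rewrite pow_add, iso_d.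
Qed.

Lemma d_pow_inv (g : isom) n x : d x (pow (inv g) n x) = d x (pow g n x).
Proof. rewrite pow_inv, d_bw. apply d_sym. Qed.

Lemma d_pow_opp (g : isom) m n x :
  d (pow (inv g) m x) (pow g n x) = d x (pow g (m + n) x).
Proof. rewrite pow_inv, d_sym, d_bw, <- pow_add, d_sym, Nat.add_comm. reflexivity. Qed.

Lemma pow_subadd (g : isom) m n x :
  d x (pow g (m + n) x) <= d x (pow g m x) + d x (pow g n x).
Proof.
  rewrite pow_add, <- (iso_d (pow g m) x (pow g n x)). apply d_tri.
Qed.

Lemma pow_linear (g : isom) n x : d x (pow g n x) <= INR n * d x (g x).
Proof.
  induction n as [|n IH]; [simpl; rewrite d_refl; lra|].
  rewrite S_INR. pose proof (pow_subadd g 1 n x) as H. simpl in H. simpl. lra.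
Qed.

(** * Translation length and growth of displacements *)

Local Notation disp g x n := (d x (fw (pow g n) x)).

Lemma tl_upper (g : isom) l c x :
  transl_length d g l -> l < c -> 0 <= c ->
  exists C, forall n, disp g x n <= C + INR n * c.
Proof.
  intros T Hc C0. destruct (T x (c - l) ltac:(lra)) as [N HN].
  exists (INR (S N) * d x (g x)). intro n.
  destruct (Nat.le_gt_cases n N) as [L|L].
  - pose proof (pow_linear g n x). assert (INR n <= INR (S N)) by (apply le_INR; lia).
    pose proof (d_nonneg x (g x)). pose proof (pos_INR n). nra.
  - destruct n as [|n]; [lia|]. specialize (HN n ltac:(lia)). unfold Rdist in HN.
    apply Rabs_def2 in HN as [HN _]. rewrite <- pow_iter in HN.
    assert (0 < INR (S n)) by (apply lt_0_INR; lia).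
    assert (disp g x (S n) / INR (S n) < c) as Q by lra.
    apply (Rmult_lt_compat_r (INR (S n))) in Q; [|lra].
    unfold Rdiv in Q. rewrite Rmult_assoc, Rinv_l, Rmult_1_r in Q by lra.
    pose proof (d_nonneg x (g x)). pose proof (pos_INR (S N)). nra.
Qed.

Lemma tl_le (g : isom) l c C x :
  transl_length d g l -> (forall n, disp g x n <= C + INR n * c) -> l <= c.
Proof.
  intros T H. apply Rnot_lt_le. intro L.
  destruct (T x ((l - c) / 2) ltac:(lra)) as [N HN].
  destruct (INR_unbounded (2 * C / (l - c))) as [k Hk].
  set (n := Nat.max N k). specialize (HN n ltac:(lia)). unfold Rdist in HN.
  apply Rabs_def2 in HN as [_ HN]. rewrite <- pow_iter in HN.
  assert (0 < INR (S n)) by (apply lt_0_INR; lia).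
  assert (INR k <= INR (S n)) by (apply le_INR; lia).
  assert ((l + c) / 2 < disp g x (S n) / INR (S n)) as Q by lra.
  apply (Rmult_lt_compat_r (INR (S n))) in Q; [|lra].
  unfold Rdiv in Q at 2. rewrite Rmult_assoc, Rinv_l, Rmult_1_r in Q by lra.
  specialize (H (S n)).
  assert (2 * C / (l - c) < INR (S n)) as K by lra.
  apply (Rmult_lt_compat_r (l - c)) in K; [|lra].
  unfold Rdiv in K. rewrite Rmult_assoc, Rinv_l, Rmult_1_r in K by lra. lra.
Qed.

Lemma tl_disp (g : isom) l x : transl_length d g l -> l <= d x (g x).
Proof.
  intro T. apply (tl_le g l _ 0 x T). intro n. pose proof (pow_linear g n x). lra.
Qed.

Lemma tl_unbounded (g : isom) l x (B : R) m :
  transl_length d g l -> 0 < l -> exists n, (m <= n)%nat /\ B < disp g x n.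
Proof.
  intros T P. apply NNPP. intro E.
  enough (l <= 0) by lra.
  apply (tl_le g l 0 (Rabs B + INR m * d x (g x)) x T). intro n.
  pose proof (Rle_abs B). pose proof (d_nonneg x (g x)).
  pose proof (pos_INR m). pose proof (Rabs_pos B).
  assert (0 <= INR m * d x (g x)) by nra.
  destruct (Nat.le_gt_cases m n) as [L|L].
  - destruct (Rle_or_lt (disp g x n) B); [lra|]. exfalso. eauto.
  - pose proof (pow_linear g n x). assert (INR n <= INR m) by (apply le_INR; lia). nra.
Qed.

Lemma tl_pow (g : isom) l k :
  transl_length d g l -> (1 <= k)%nat -> transl_length d (pow g k) (INR k * l).
Proof.
  intros T Hk x eps He.
  assert (0 < INR k) as Pk by (apply lt_0_INR; lia).
  destruct (T x (eps / INR k)) as [N HN]; [now apply Rdiv_lt_0_compat|].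
  exists N. intros n Hn.
  specialize (HN (S n * k - 1)%nat ltac:(nia)). unfold Rdist in *.
  replace (S (S n * k - 1)) with (S n * k)%nat in HN by nia.
  rewrite <- pow_iter, pow_mul, mult_INR in HN. rewrite <- pow_iter.
  assert (0 < INR (S n)) as Pn by (apply lt_0_INR; lia).
  replace (disp (pow g k) x (S n) / INR (S n) - INR k * l)
    with (INR k * (disp (pow g k) x (S n) / (INR (S n) * INR k) - l)) by (field; lra).
  rewrite Rabs_mult, (Rabs_pos_eq (INR k)) by lra.
  apply (Rmult_lt_compat_l (INR k)) in HN; [|lra].
  replace (INR k * (eps / INR k)) with eps in HN by (field; lra). exact HN.
Qed.

Lemma tl_inv (g : isom) l : transl_length d g l -> transl_length d (inv g) l.
Proof.
  intros T x. apply (Un_cv_ext (fun n => d x (Nat.iter (S n) g x) / INR (S n))); [|apply T].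
  intro n. now rewrite <- !pow_iter, d_pow_inv.
Qed.

(** * Four-point estimates for the displacement sequence *)

Lemma argmax (f : nat -> R) n : exists q, (q <= n)%nat /\ forall j, (j <= n)%nat -> f j <= f q.
Proof.
  induction n as [|n (q & Hq & H)].
  - exists 0%nat. split; [lia|]. intros j Hj. replace j with 0%nat by lia. lra.
  - destruct (Rle_or_lt (f (S n)) (f q)) as [L|L].
    + exists q. split; [lia|]. intros j Hj.
      destruct (Nat.eq_dec j (S n)) as [->|]; [lra|apply H; lia].
    + exists (S n). split; [lia|]. intros j Hj.
      destruct (Nat.eq_dec j (S n)) as [->|]; [lra|].
      specialize (H j ltac:(lia)). lra.
Qed.

Lemma running_max (g : isom) l x m :
  transl_length d g l -> 0 < l ->
  exists q, (m <= q)%nat /\ forall j, (j <= q)%nat -> disp g x j <= disp g x q.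
Proof.
  intros T P. destruct (argmax (fun n => disp g x n) m) as (q0 & _ & H0).
  destruct (tl_unbounded g l x (disp g x q0) m T P) as (n & Ln & Hn).
  destruct (argmax (fun n => disp g x n) n) as (q & Lq & H).
  exists q. split.
  - destruct (Nat.le_gt_cases m q) as [|L]; [assumption|].
    specialize (H0 q ltac:(lia)). specialize (H n ltac:(lia)). simpl in *. lra.
  - intros j Hj. apply H. lia.
Qed.

(** Otherwise the four-point inequality for x, g x, g^2 x, g^(n+2) x gives s_(n+2) <= s_n + 2 delta
    or s_(n+2) <= s_(n+1) + s_2 - s_1 + 2 delta. Both allow growth at rate at most [c], which is
    less than [l]. *)
Lemma disp_two (g : isom) l x :
  transl_length d g l -> delta < l -> disp g x 1 + l - 2 * delta <= disp g x 2.
Proof.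
  intros T P. apply Rnot_lt_le. intro L.
  pose proof (delta_nonneg x) as D0.
  set (c := Rmax delta (disp g x 2 - disp g x 1 + 2 * delta)).
  assert (C1 : delta <= c) by apply Rmax_l.
  assert (C2 : disp g x 2 - disp g x 1 + 2 * delta <= c) by apply Rmax_r.
  assert (C3 : c < l) by (unfold c; apply Rmax_lub_lt; lra).
  enough (l <= c) by lra.
  apply (tl_le g l c (disp g x 1) x T). intro n.
  pose proof (d_nonneg x (g x)) as P1.
  enough (disp g x n <= disp g x 1 + INR n * c /\
          disp g x (S n) <= disp g x 1 + INR (S n) * c) by tauto.
  induction n as [|n [IH1 IH2]].
  - simpl INR. change (disp g x 0) with (d x x). rewrite d_refl.
    change (disp g x 1) with (d x (g x)) in *. lra.
  - split; [exact IH2|]. rewrite !S_INR in *.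
    pose proof (four_point x (pow g 1 x) (pow g (S (S n)) x) (pow g 2 x)) as F.
    rewrite (d_sym (pow g (S (S n)) x)) in F.
    rewrite !d_pow in F by lia.
    replace (S (S n) - 2)%nat with n in F by lia.
    replace (S (S n) - 1)%nat with (S n) in F by lia.
    replace (2 - 1)%nat with 1%nat in F by lia. lra.
Qed.

Lemma disp_add (g : isom) l x n p :
  transl_length d g l -> 0 < l -> (1 <= n)%nat ->
  disp g x (n + p) <= disp g x n + 2 * delta \/
  disp g x (n + p) <= disp g x p + INR n * l + 2 * delta.
Proof.
  intros T P Hn. apply NNPP. intros [K1 K2]%not_or_and.
  apply Rnot_le_lt in K1, K2.
  assert (Pn : 0 < INR n) by (apply lt_0_INR; lia).
  (* [kappa] and [lam] measure by how much the two alternatives fail. By the four-point inequality,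
     from every index [q] at least [p], stepping back by [p] or forward by [n] then increases the
     displacement by [kappa] or [lam]. *)
  set (kappa := disp g x (n + p) - disp g x n - 2 * delta).
  set (lam := disp g x (n + p) - disp g x p - 2 * delta).
  assert (Step : forall q, (p <= q)%nat ->
    disp g x q <= disp g x (q - p) - kappa \/ disp g x q <= disp g x (q + n) - lam).
  { intros q Hq.
    pose proof (four_point x (pow g n x) (pow g (n + p) x) (pow g (q + n) x)) as F.
    rewrite !d_pow in F by lia.
    replace (q + n - (n + p))%nat with (q - p)%nat in F by lia.
    replace (q + n - n)%nat with q in F by lia.
    replace (n + p - n)%nat with p in F by lia. unfold kappa, lam. lra. }
  (* The slope lies strictly between [l] and [lam / INR n]: above [l], so that s_q - q c is bounded
     above, and below [lam / INR n], so that a step forward by [n] still increases it. *)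
  set (c := (l + lam / INR n) / 2).
  assert (Hc : l < c /\ INR n * c < lam).
  { assert (l < lam / INR n).
    { apply (Rmult_lt_reg_l (INR n)); [lra|]. unfold Rdiv.
      rewrite (Rmult_comm lam), <- Rmult_assoc, Rinv_r, Rmult_1_l by lra. unfold lam. lra. }
    split; [unfold c; lra|]. unfold c.
    replace (INR n * ((l + lam / INR n) / 2)) with ((INR n * l + lam) / 2) by (field; lra).
    unfold lam; lra. }
  destruct Hc as [Hc1 Hc2].
  destruct (tl_upper g l c x T Hc1 ltac:(lra)) as [C HC].
  destruct (argmax (fun n => disp g x n) p) as (q0 & _ & H0). cbv beta in H0.
  (* An index [q] with [s q > s q0] and [s q - c q] almost maximal contradicts [Step]:
     both alternatives increase [s q - c q] by a fixed amount. *)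
  set (E := fun v => exists q, disp g x q0 < disp g x q /\ v = disp g x q - INR q * c).
  destruct (completeness E) as [S [S1 S2]].
  - exists C. intros v (q & _ & ->). specialize (HC q). lra.
  - destruct (tl_unbounded g l x (disp g x q0) 0 T P) as (q & _ & Hq).
    exists (disp g x q - INR q * c). now exists q.
  - set (eta := Rmin kappa (lam - INR n * c)).
    assert (Eta1 : eta <= kappa) by apply Rmin_l.
    assert (Eta2 : eta <= lam - INR n * c) by apply Rmin_r.
    assert (Eta0 : 0 < eta) by (apply Rmin_glb_lt; [unfold kappa; lra|lra]).
    assert (exists q, disp g x q0 < disp g x q /\ S - eta < disp g x q - INR q * c)
      as (q & Hq & Mq).
    { apply NNPP. intro N. enough (S <= S - eta) by lra. apply S2.
      intros v (q & Hq & ->). apply Rnot_lt_le. intro. apply N. now exists q. }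
    assert (Lq : (p <= q)%nat).
    { destruct (Nat.le_gt_cases p q) as [|L]; [assumption|].
      specialize (H0 q ltac:(lia)). lra. }
    destruct (Step q Lq) as [J|J].
    + assert (M : E (disp g x (q - p) - INR (q - p) * c)) by (exists (q - p)%nat; split; [lra|reflexivity]).
      apply S1 in M. rewrite minus_INR in M by lia. pose proof (pos_INR p). nra.
    + assert (M : E (disp g x (q + n) - INR (q + n) * c)).
      { exists (q + n)%nat; split; [|reflexivity].
        assert (0 < INR n * c) by nra. lra. }
      apply S1 in M. rewrite plus_INR in M. lra.
Qed.

(** The four-point inequality for g^(q-n) x, x, g^(q-p) x, g^q x, with s_q a running maximum:
    s_(q-n) and s_(q-p) are at most s_q and cancel against it. *)
Lemma disp_sub (g : isom) l x n p :
  transl_length d g l -> 0 < l ->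
  d (pow g n x) (pow g p x) <= disp g x n + 2 * delta \/
  d (pow g n x) (pow g p x) <= disp g x p + 2 * delta.
Proof.
  intros T P.
  destruct (running_max g l x (n + p) T P) as (q & Lq & Hq).
  pose proof (four_point (pow g (q - n) x) x (pow g (q - p) x) (pow g q x)) as F.
  rewrite (d_sym (pow g (q - n) x) x) in F.
  rewrite (d_pow g (q - n) q), (d_pow g (q - p) q) in F by lia.
  replace (q - (q - n))%nat with n in F by lia.
  replace (q - (q - p))%nat with p in F by lia.
  pose proof (Hq (q - n)%nat ltac:(lia)). pose proof (Hq (q - p)%nat ltac:(lia)).
  enough (d (pow g (q - n) x) (pow g (q - p) x) = d (pow g n x) (pow g p x)) by lra.
  destruct (Nat.le_ge_cases n p) as [L|L].
  - rewrite d_sym, !d_pow by lia. do 3 f_equal. lia.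
  - rewrite (d_sym (pow g n x)), !d_pow by lia. do 3 f_equal. lia.
Qed.

(** This allows a power with large n l to be replaced by [g] itself without increasing the
    displacement of [x]. *)
Lemma disp_one_le (g : isom) l x n :
  transl_length d g l -> 0 < l -> (2 <= n)%nat -> 13 * delta < INR n * l ->
  disp g x 1 <= disp g x n.
Proof.
  intros T P Hn Hl. apply Rnot_lt_le. intro L.
  assert (Tn : transl_length d (pow g n) (INR n * l)) by (apply tl_pow; [assumption|lia]).
  pose proof (delta_nonneg x) as D0.
  pose proof (disp_two _ _ x Tn ltac:(lra)) as H2.
  change (disp (pow g n) x 1) with (disp g x n) in H2.
  replace (disp (pow g n) x 2) with (disp g x (2 * n)) in H2 by (now rewrite pow_mul).
  (* Hence n l - l is at least half of n l, so more than 13/2 delta, whereas the last alternative of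
     [disp_add] would force it below 6 delta. *)
  assert (H : 2 * l <= INR n * l).
  { apply Rmult_le_compat_r; [lra|]. now apply (le_INR 2). }
  destruct n as [|n]; [lia|].
  (* Of the products of [g x] with [g^n x] and [g^-n x] at [x], one is small. *)
  pose proof (four_point x (pow g (S n) x) (pow g (2 * S n) x) (pow g (S (S n)) x)) as F.
  rewrite (d_sym (pow g (2 * S n) x)) in F. rewrite !d_pow in F by lia.
  replace (S (S n) - S n)%nat with 1%nat in F by lia.
  replace (2 * S n - S (S n))%nat with n in F by lia.
  replace (2 * S n - S n)%nat with (S n) in F by lia.
  assert (disp g x 1 + INR (S n) * l - 4 * delta <= disp g x n \/
          disp g x 1 + INR (S n) * l - 4 * delta <= disp g x (S (S n))) as [B|B] by lra.
  - destruct (disp_sub g l x (S n) 1 T P) as [G|G];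
      rewrite (d_sym (pow g (S n) x)), d_pow in G by lia;
      replace (S n - 1)%nat with n in G by lia; lra.
  - destruct (disp_add g l x 1 (S n) T P ltac:(lia)) as [G|G];
      change (1 + S n)%nat with (S (S n)) in G; simpl INR in G; lra.
Qed.

(** The inductive step of both word arguments: stripping the first factor [g] turns the wanted lower
    bound on a product into an upper bound. *)
Lemma gromov_shift (g : isom) x y :
  gromov d x (g x) (g y) = d x (g x) - gromov d x (bw g x) y.
Proof.
  rewrite gromov_swap. f_equal. rewrite <- (gromov_iso g x), fw_bw. reflexivity.
Qed.

(** * Margulis constant and free groups *)

(** Applying [interpolation] to the point m and then to its image bounds d(m, g^n m) by one of s_n -
    3 delta, s_(n+p) - s_p + 2 delta, d(g^n x, g^p x) - s_p + 2 delta, s_n - 2 s_p + 7 delta. With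
    [disp_add] and [disp_sub], each is below L - 2 delta. *)
Lemma descent (g : isom) l x L n0 p c :
  transl_length d g l -> 0 < l -> l <= 13 * delta -> 23 * delta < L ->
  (1 <= n0)%nat -> disp g x n0 <= L + delta / 4 ->
  15 / 2 * delta <= disp g x p -> geodesic_seg d x (pow g p x) c ->
  exists n, (1 <= n)%nat /\
    d (c (5 / 2 * delta)) (pow g n (c (5 / 2 * delta))) < L - 2 * delta.
Proof.
  intros T P Hl HL Hn0 Hs Hp G.
  (* The bound on n l serves the case where [disp_add] yields n l + 4 delta: this is at most 17
     delta, while L - 2 delta exceeds 21 delta. *)
  assert (exists n, (1 <= n)%nat /\ disp g x n <= L + delta / 4 /\ INR n * l <= 13 * delta)
    as (n & Hn & Sn & Ln).
  { destruct (Rle_or_lt (INR n0 * l) (13 * delta)) as [K|K]; [now exists n0|].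
    exists 1%nat. split; [lia|]. split; [|simpl; lra].
    assert (n0 <> 1%nat) by (intros ->; simpl in K; lra).
    pose proof (disp_one_le g l x n0 T P ltac:(lia) K). lra. }
  exists n. split; [assumption|].
  pose proof (fun z => interpolation x (pow g p x) c (5 / 2 * delta) z G ltac:(lra)) as I.
  set (m := c (5 / 2 * delta)) in *. set (y := pow g p x) in *.
  pose proof (I (pow g n m)) as I1.
  pose proof (I (bw (pow g n) x)) as I2. pose proof (I (bw (pow g n) y)) as I3.
  rewrite !d_bw in I2, I3.
  rewrite (d_sym x (pow g n m)), (d_sym y (pow g n m)) in I1.
  assert (E1 : d (pow g n y) x = disp g x (n + p)) by (unfold y; rewrite <- pow_add; apply d_sym).
  assert (E2 : d (pow g n x) x = disp g x n) by apply d_sym.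
  assert (E3 : d (pow g n y) y = disp g x n) by (unfold y; rewrite pow_comm, iso_d; apply d_sym).
  pose proof (disp_add g l x n p T P Hn) as D1. fold y in D1.
  pose proof (disp_sub g l x n p T P) as D2. fold y in D2.
  rewrite E1, E2 in I2. rewrite E3 in I3. lra.
Qed.

(** Were the displacement by g^n smaller, h^m would move [x] by at least [L] and [descent] would
    apply along [x, h^m x]. At the new point some power of [h] moves less than L - 2 delta and g^n
    less than 15/2 delta + 5 delta, both below [L]. *)
Lemma short_segment_bound (g h : isom) lh x L n m :
  transl_length d h lh -> 0 < lh -> lh <= 13 * delta -> 23 * delta < L ->
  (forall y i j, (1 <= i)%nat -> (1 <= j)%nat -> L <= disp g y i \/ L <= disp h y j) ->
  (1 <= n)%nat -> (1 <= m)%nat -> disp h x m <= L + delta / 4 ->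
  15 / 2 * delta <= disp g x n.
Proof.
  intros T P Hl HL Low Hn Hm Hs. apply Rnot_lt_le. intro K.
  assert (Hhm : L <= disp h x m) by (destruct (Low x n m Hn Hm); lra).
  pose proof HX as (_ & Hg & _). destruct (Hg x (pow h m x)) as [c G].
  destruct (descent h lh x L m m c T P Hl HL Hm Hs ltac:(lra) G) as (k & Hk & Dk).
  destruct (geodesic_point x _ c (5 / 2 * delta) G ltac:(lra)) as [E _].
  set (y := c _) in *.
  assert (d y (pow g n y) <= d x (pow g n x) + 2 * d x y).
  { pose proof (d_tri y x (pow g n y)). pose proof (d_tri x (pow g n x) (pow g n y)).
    rewrite iso_d in *. rewrite (d_sym y x) in *. lra. }
  destruct (Low y n k Hn Hk); lra.
Qed.

(** Otherwise the points at distance 5/2 delta on the two segments are [delta]-close. The margin 2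
    delta in [descent] pays for carrying the displacement by a power of [h] from one to the other,
    so a single point contradicts [Low]. *)
Lemma margulis_gromov_bound (g h : isom) lg lh x L n0 m0 n m :
  transl_length d g lg -> 0 < lg -> lg <= 13 * delta ->
  transl_length d h lh -> 0 < lh -> lh <= 13 * delta -> 23 * delta < L ->
  (forall y i j, (1 <= i)%nat -> (1 <= j)%nat -> L <= disp g y i \/ L <= disp h y j) ->
  (1 <= n0)%nat -> (1 <= m0)%nat ->
  disp g x n0 <= L + delta / 4 -> disp h x m0 <= L + delta / 4 ->
  15 / 2 * delta <= disp g x n -> 15 / 2 * delta <= disp h x m ->
  gromov d x (pow g n x) (pow h m x) <= 5 / 2 * delta.
Proof.
  intros Tg Pg Hg Th Ph Hh HL Low Hn0 Hm0 Sg Sh Ln Lm.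
  apply Rnot_lt_le. intro K.
  pose proof HX as (_ & Geo & _ & Thin).
  destruct (Geo x (pow g n x)) as [c1 G1], (Geo x (pow h m x)) as [c2 G2].
  destruct (Geo (pow g n x) (pow h m x)) as [c3 G3].
  destruct (Thin _ _ _ c1 c2 c3 G1 G2 G3) as (H & _).
  specialize (H (5 / 2 * delta) ltac:(lra)).
  destruct (descent g lg x L n0 n c1 Tg Pg Hg HL Hn0 Sg Ln G1) as (i & Hi & Di).
  destruct (descent h lh x L m0 m c2 Th Ph Hh HL Hm0 Sh Lm G2) as (j & Hj & Dj).
  set (y := c1 _) in *. set (z := c2 _) in *.
  assert (d y (pow h j y) <= d z (pow h j z) + 2 * d y z).
  { pose proof (d_tri y z (pow h j y)). pose proof (d_tri z (pow h j z) (pow h j y)).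
    rewrite iso_d in *. rewrite (d_sym z y) in *. lra. }
  destruct (Low y i j Hi Hj); lra.
Qed.

(** * Ping-pong on the syllables of reduced words *)

Definition letter_isom (A B : isom) (l : letter) : isom :=
  match l with
  | (Ga, false) => A | (Ga, true) => inv A
  | (Gb, false) => B | (Gb, true) => inv B
  end.

Lemma letter_isomE (A B : isom) l x : letter_isom A B l x = eval_letter A (bw A) B (bw B) l x.
Proof. now destruct l as [[] []]. Qed.

Lemma pow_bw (g : isom) n x : bw (pow (inv g) n) x = pow g n x.
Proof. apply (fw_inj (pow (inv g) n)). now rewrite fw_bw, pow_inv, bw_fw. Qed.

Lemma pow_letter_inv (A B : isom) l n x :
  pow (letter_isom A B (inv_letter l)) n x = bw (pow (letter_isom A B l) n) x.
Proof.
  destruct l as [[] []]; cbn [letter_isom inv_letter fst snd negb];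
    first [now rewrite pow_bw|now rewrite pow_inv].
Qed.

Lemma leading_syllable (A B : isom) w l0 :
  reduced (l0 :: w) ->
  exists n w', (1 <= n)%nat /\ (length w' <= length w)%nat /\ reduced w' /\
    (forall x, eval_word A (bw A) B (bw B) (l0 :: w) x =
               pow (letter_isom A B l0) n (eval_word A (bw A) B (bw B) w' x)) /\
    (w' = nil \/ exists l' w'', w' = l' :: w'' /\ fst l' <> fst l0).
Proof.
  revert l0; induction w as [|l1 w IH]; intros l0 R.
  - exists 1%nat, nil. repeat split; try lia; [|now left].
    intro x. symmetry. apply letter_isomE.
  - destruct R as [R1 R2].
    assert (fst l1 <> fst l0 \/ l1 = l0) as [N| ->].
    { destruct l0 as [[] []], l1 as [[] []]; cbn in *; (now right) || (left; discriminate) || congruence. }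
    + exists 1%nat, (l1 :: w). repeat split; try lia; [exact R2| |right; eauto].
      intro x. symmetry. apply letter_isomE.
    + destruct (IH l0 R2) as (n & w' & Hn & Hlen & R' & E & H').
      exists (S n), w'. repeat split; try lia; try assumption; [simpl; lia|].
      intro x. cbn [eval_word] in *. rewrite E, <- letter_isomE. reflexivity.
Qed.

Lemma pingpong_free (A B : isom) x t :
  (forall l n, (1 <= n)%nat -> 2 * t + 2 * delta < disp (letter_isom A B l) x n) ->
  (forall l1 l2 n m, fst l1 <> fst l2 -> (1 <= n)%nat -> (1 <= m)%nat ->
     gromov d x (pow (letter_isom A B l1) n x) (pow (letter_isom A B l2) m x) <= t) ->
  free_group_on A (bw A) B (bw B).
Proof.
  intros Len Prod.
  assert (T0 : 0 <= t).
  { pose proof (Prod (Ga, false) (Gb, false) 1%nat 1%nat ltac:(discriminate) ltac:(lia) ltac:(lia)).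
    pose proof (gromov_bounds x (pow (letter_isom A B (Ga, false)) 1 x)
      (pow (letter_isom A B (Gb, false)) 1 x)). lra. }
  pose proof (delta_nonneg x) as D0.
  (* The orbit point of a word leaves [x] in the direction of its first syllable. The induction is
     on a bound for the length, because removing a syllable may remove several letters. *)
  assert (Claim : forall k l0 w, (length w <= k)%nat -> reduced (l0 :: w) ->
    exists n, (1 <= n)%nat /\ t + delta <
      gromov d x (pow (letter_isom A B l0) n x) (eval_word A (bw A) B (bw B) (l0 :: w) x)).
  { induction k as [|k IH]; intros l0 w Hk R;
      destruct (leading_syllable A B w l0 R) as (n & w' & Hn & Hlen & R' & E & H');
      exists n; (split; [assumption|]); rewrite E; pose proof (Len l0 n Hn) as Ln.
    - destruct w' as [|]; [|simpl in Hlen; lia]. cbn [eval_word]. rewrite gromov_diag. lra.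
    - destruct H' as [->|(l' & w'' & -> & Hl)].
      + cbn [eval_word]. rewrite gromov_diag. lra.
      + simpl in Hlen. destruct (IH l' w'' ltac:(lia) R') as (m & Hm & G).
        set (y := eval_word A (bw A) B (bw B) (l' :: w'') x) in *.
        pose proof (Prod (inv_letter l0) l' n m ltac:(simpl; congruence) Hn Hm) as Q.
        rewrite pow_letter_inv in Q. set (g := pow (letter_isom A B l0) n) in *.
        rewrite gromov_shift. rewrite gromov_sym in G.
        destruct (gromov_ineq x (bw g x) y (pow (letter_isom A B l') m x)); lra. }
  intros [|l0 w] Hw R; [congruence|]. exists x. intro E.
  destruct (Claim _ l0 w (le_n _) R) as (n & _ & G).
  rewrite E, gromov_base in G. lra.
Qed.

(** * Displacements of powers and the Margulis constant of the pair *)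

Lemma disp_letter A B x l n :
  disp (letter_isom A B l) x n = match fst l with Ga => disp A x n | Gb => disp B x n end.
Proof. destruct l as [[] []]; cbn; rewrite ?d_pow_inv; reflexivity. Qed.

Lemma zpow_disp (g : isom) p x : d x (zpow g (bw g) p x) = disp g x (Z.abs_nat p).
Proof.
  destruct p as [|p|p]; simpl.
  - reflexivity.
  - now rewrite pow_iter.
  - rewrite <- d_pow_inv, pow_iter. reflexivity.
Qed.

Lemma disp_pos (g : isom) l n x :
  transl_length d g l -> 0 < l -> (1 <= n)%nat -> 0 < disp g x n.
Proof.
  intros T P Hn. pose proof (tl_disp _ _ x (tl_pow g l n T Hn)).
  assert (0 < INR n) by (apply lt_0_INR; lia). nra.
Qed.

Lemma zpow_nontrivial (g : isom) l p (x : X) :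
  transl_length d g l -> 0 < l -> p <> 0%Z -> nontrivial (zpow g (bw g) p).
Proof.
  intros T P Hp. exists x. intro E.
  pose proof (zpow_disp g p x) as H. rewrite E, d_refl in H.
  pose proof (disp_pos g l (Z.abs_nat p) x T P ltac:(lia)). lra.
Qed.

Section Margulis.
Context (A B : isom) (la lb L : R).
Context (Ta : transl_length d A la) (Tb : transl_length d B lb).
Context (Pa : 0 < la) (Pb : 0 < lb).
Context (HM : margulis_const d A (bw A) B (bw B) L).

Lemma margulis_lower x n m :
  (1 <= n)%nat -> (1 <= m)%nat -> L <= disp A x n \/ L <= disp B x m.
Proof.
  intros Hn Hm. destruct HM as [Low _].
  specialize (Low (Rmax (disp A x n) (disp B x m))).
  apply Rmax_Rle, Low. exists x, (Z.of_nat n), (Z.of_nat m).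
  repeat split; try lia.
  - eapply zpow_nontrivial; eauto; lia.
  - eapply zpow_nontrivial; eauto; lia.
  - now rewrite !zpow_disp, !Zabs2Nat.id.
Qed.

Lemma margulis_near e :
  0 < e -> exists x n m, (1 <= n)%nat /\ (1 <= m)%nat /\
    disp A x n <= L + e /\ disp B x m <= L + e.
Proof.
  intro He. destruct HM as [_ Inf]. apply NNPP. intro N.
  enough (L + e <= L) by lra. apply Inf.
  intros r (x & p & q & Hp & Hq & _ & _ & ->). apply Rnot_lt_le. intro K.
  apply N. exists x, (Z.abs_nat p), (Z.abs_nat q). rewrite <- !zpow_disp.
  pose proof (Rmax_l (d x (zpow A (bw A) p x)) (d x (zpow B (bw B) q x))).
  pose proof (Rmax_r (d x (zpow A (bw A) p x)) (d x (zpow B (bw B) q x))).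
  repeat split; try lia; lra.
Qed.

Lemma free_of_margulis :
  la <= 13 * delta -> lb <= 13 * delta -> L > 23 * delta ->
  free_group_on A (bw A) B (bw B).
Proof.
  intros Ha Hb HL.
  (* The infimum need not be attained; [delta / 4] is the slack that [descent] tolerates. *)
  destruct (margulis_near (delta / 4) ltac:(lra)) as (x & n0 & m0 & Hn0 & Hm0 & Sa & Sb).
  assert (LA : forall n, (1 <= n)%nat -> 15 / 2 * delta <= disp A x n).
  { intros n Hn. apply (short_segment_bound A B lb x L n m0 Tb Pb Hb); auto.
    intros; now apply margulis_lower. }
  assert (LB : forall n, (1 <= n)%nat -> 15 / 2 * delta <= disp B x n).
  { intros n Hn. apply (short_segment_bound B A la x L n n0 Ta Pa Ha); auto.
    intros y i j Hi Hj. apply or_comm. now apply margulis_lower. }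
  (* Here 2 t + 2 delta = 7 delta, below the displacement bound 15/2 delta. *)
  apply (pingpong_free A B x (5 / 2 * delta)).
  - intros l n Hn. rewrite disp_letter.
    destruct (fst l); [specialize (LA n Hn)|specialize (LB n Hn)]; lra.
  - assert (Main : forall s1 s2 n m, (1 <= n)%nat -> (1 <= m)%nat ->
      gromov d x (pow (letter_isom A B (Ga, s1)) n x) (pow (letter_isom A B (Gb, s2)) m x)
        <= 5 / 2 * delta).
    { intros s1 s2 n m Hn Hm.
      apply (margulis_gromov_bound _ _ la lb x L n0 m0); rewrite ?disp_letter; cbn [fst];
        auto; try lra.
      - destruct s1; [now apply tl_inv|assumption].
      - destruct s2; [now apply tl_inv|assumption].
      - intros y i j Hi Hj. rewrite !disp_letter. now apply margulis_lower. }
    intros [g1 s1] [g2 s2] n m Hg Hn Hm.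
    destruct g1, g2; try (now destruct Hg); [|rewrite gromov_sym]; now apply Main.
Qed.

End Margulis.

(** * Orbits of isometries with large translation length *)

(** By induction each increment after the first is at least s_2 - s_1 - 2 delta. Since s_2 - s_1 > 2
    delta by [disp_two], the other four-point alternative is impossible. *)
Lemma disp_step (g : isom) l x k :
  transl_length d g l -> 4 * delta < l -> disp g x k + (l - 4 * delta) <= disp g x (S k).
Proof.
  intros T P. pose proof (delta_nonneg x) as D0.
  pose proof (disp_two g l x T ltac:(lra)) as H2.
  destruct k as [|k].
  - change (disp g x 0) with (d x x). rewrite d_refl.
    pose proof (tl_disp g l x T). simpl in *. lra.
  - enough (disp g x (S k) + (disp g x 2 - disp g x 1) - 2 * delta <= disp g x (S (S k))) by lra.
    induction k as [|k IH]; [lra|].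
    pose proof (four_point x (pow g 1 x) (pow g 2 x) (pow g (S (S (S k))) x)) as F.
    rewrite !d_pow in F by lia.
    replace (2 - 1)%nat with 1%nat in F by lia.
    replace (S (S (S k)) - 1)%nat with (S (S k)) in F by lia.
    replace (S (S (S k)) - 2)%nat with (S k) in F by lia. lra.
Qed.

Lemma disp_lower (g : isom) l x k :
  transl_length d g l -> 4 * delta < l -> INR k * (l - 4 * delta) <= disp g x k.
Proof.
  intros T P. induction k as [|k IH]; [simpl INR; pose proof (d_nonneg x (pow g 0 x)); lra|].
  rewrite S_INR. pose proof (disp_step g l x k T P). lra.
Qed.

(** Orbits are almost geodesic. The alternative s_(j+1) + s_k <= s_j + s_(k-1) + 2 delta contradicts
    [disp_step], because 2 (l - 4 delta) > 2 delta. *)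
Lemma disp_superadd (g : isom) l x j k :
  transl_length d g l -> 5 * delta < l ->
  disp g x j + disp g x k <= disp g x (j + k) + disp g x 1 + 2 * delta.
Proof.
  intros T P. pose proof (delta_nonneg x) as D0.
  destruct k as [|k].
  { rewrite Nat.add_0_r. change (disp g x 0) with (d x x). rewrite d_refl.
    pose proof (d_nonneg x (pow g 1 x)). lra. }
  pose proof (four_point x (pow g j x) (pow g (S j) x) (pow g (j + S k) x)) as F.
  rewrite !d_pow in F by lia.
  replace (j + S k - j)%nat with (S k) in F by lia.
  replace (j + S k - S j)%nat with k in F by lia.
  replace (S j - j)%nat with 1%nat in F by lia.
  pose proof (disp_step g l x j T ltac:(lra)). pose proof (disp_step g l x k T ltac:(lra)). lra.
Qed.

Lemma near_orbit (g : isom) l x y n :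
  transl_length d g l -> 5 * delta < l ->
  exists k, d y (pow g k x) <=
    gromov d y x (pow g n x) + 2 * disp g x 1 + 4 * delta.
Proof.
  intros T P. pose proof (gromov_bounds x y (pow g n x)) as B.
  (* Displacements grow by at most s_1 per step, so some orbit point is, up to s_1, as far from [x]
     as the projection of [y]. *)
  assert (I : forall n t, 0 <= t <= disp g x n ->
    exists k, (k <= n)%nat /\ disp g x k <= t <= disp g x k + disp g x 1).
  { clear - HX. induction n as [|n IH]; intros t Ht.
    - exists 0%nat. split; [lia|]. change (disp g x 0) with (d x x) in *. rewrite d_refl in *.
      pose proof (d_nonneg x (pow g 1 x)). lra.
    - destruct (Rle_or_lt t (disp g x n)) as [L|L].
      + destruct (IH t ltac:(lra)) as (k & Hk & H). exists k. split; [lia|exact H].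
      + exists n. split; [lia|]. pose proof (pow_subadd g 1 n x).
        change (1 + n)%nat with (S n) in *. lra. }
  destruct (I n (gromov d x y (pow g n x)) ltac:(lra)) as (k & Hk & H). exists k.
  pose proof (four_point y x (pow g k x) (pow g n x)) as F.
  rewrite d_pow in F by lia.
  pose proof (disp_superadd g l x k (n - k) T P) as S.
  replace (k + (n - k))%nat with n in S by lia.
  rewrite (gromov_swap x y) in H.
  pose proof (delta_nonneg x). pose proof (d_nonneg x (pow g 1 x)).
  unfold gromov in *. rewrite (d_sym y x) in *. lra.
Qed.

(** * The generated group and finiteness from discreteness *)

Section Group.
Context (A B : isom).
Local Notation ev := (eval_word A (bw A) B (bw B)).

Fixpoint word_isom (w : list letter) : isom :=
  match w with nil => pow A 0 | l :: w' => comp (letter_isom A B l) (word_isom w') end.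

Lemma word_isomE w x : word_isom w x = ev w x.
Proof.
  induction w as [|l w IH]; [reflexivity|].
  cbn [word_isom eval_word]. rewrite <- IH, <- letter_isomE. reflexivity.
Qed.

Lemma ev_app w1 w2 x : ev (w1 ++ w2) x = ev w1 (ev w2 x).
Proof. induction w1 as [|l w IH]; [reflexivity|]. cbn. now rewrite IH. Qed.

Lemma ev_inv_word w x : ev (inv_word w) x = bw (word_isom w) x.
Proof.
  revert x; induction w as [|l w IH]; intro x; [reflexivity|].
  unfold inv_word in *. cbn [map rev]. rewrite ev_app, IH. cbn. f_equal.
  now destruct l as [[] []].
Qed.

Lemma ev_rep_word w n x : ev (rep_word n w) x = pow (word_isom w) n x.
Proof.
  induction n as [|n IH]; [reflexivity|]. cbn. now rewrite ev_app, IH, <- word_isomE.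
Qed.

Definition in_group (g : isom) : Prop := exists w, forall x, g x = ev w x.

Lemma in_group_A : in_group A.
Proof. now exists ((Ga, false) :: nil). Qed.

Lemma in_group_B : in_group B.
Proof. now exists ((Gb, false) :: nil). Qed.

Lemma in_group_comp g h : in_group g -> in_group h -> in_group (comp g h).
Proof.
  intros [w1 H1] [w2 H2]. exists (w1 ++ w2). intro x.
  rewrite ev_app, <- H2, <- H1. reflexivity.
Qed.

Lemma in_group_inv g : in_group g -> in_group (inv g).
Proof.
  intros [w H]. exists (inv_word w). intro x. rewrite ev_inv_word.
  apply (fw_inj (word_isom w)). rewrite fw_bw, word_isomE, <- H. apply (fw_bw g).
Qed.

Lemma in_group_pow g n : in_group g -> in_group (pow g n).
Proof.
  intro H. induction n as [|n IH]; [now exists nil|]. now apply in_group_comp.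
Qed.

Lemma ball_net o r eta :
  0 < eta -> exists l, forall y, d o y <= r -> exists z, In z l /\ d z y < eta.
Proof.
  intro He. destruct HX as (_ & _ & Hp & _).
  destruct (Hp o r X (fun z y => d z y < eta)) as [l Hl].
  - intros z y Hy. exists (eta - d z y). split; [lra|]. intros y' Hy'.
    pose proof (d_tri z y y'). lra.
  - intros y _. exists y. now rewrite d_refl.
  - exists l. exact Hl.
Qed.

(** Total boundedness of the words acting on the finite set [ys]: the words are split according to
    the small ball that contains the image of the next point. Quantifying over [P] lets the
    induction refine the class of words. *)
Lemma finite_net_of_words ys eta o C (P : list letter -> Prop) :
  0 < eta -> (forall w, P w -> d o (ev w o) <= C) ->
  exists l, forall w, P w ->
    exists w', In w' l /\ P w' /\ forall y, In y ys -> d (ev w y) (ev w' y) < eta.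
Proof.
  intros He. revert P. induction ys as [|y ys IH]; intros P HP.
  - destruct (classic (exists w, P w)) as [[w Hw]|N].
    + exists (w :: nil). intros w' _. exists w. split; [now left|]. split; [assumption|].
      intros y [].
    + exists nil. intros w Hw. exfalso. eauto.
  - destruct (ball_net o (C + d o y) (eta / 2) ltac:(lra)) as [zs Hzs].
    assert (exists l, forall w, P w -> (exists z, In z zs /\ d z (ev w y) < eta / 2) ->
      exists w', In w' l /\ P w' /\ forall y', In y' (y :: ys) -> d (ev w y') (ev w' y') < eta)
      as [l Hl].
    { clear Hzs. induction zs as [|z zs [l Hl]].
      - exists nil. intros w _ (z & [] & _).
      - destruct (IH (fun w => P w /\ d z (ev w y) < eta / 2)) as [l' Hl'].
        { intros w [Hw _]. auto. }
        exists (l' ++ l). intros w Hw (z' & [->|Hz'] & D).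
        + destruct (Hl' w (conj Hw D)) as (w' & I & [P' D'] & H).
          exists w'. split; [apply in_or_app; now left|]. split; [assumption|].
          intros y' [<-|Hy']; [|now apply H].
          pose proof (d_tri (ev w y) z' (ev w' y)). rewrite (d_sym (ev w y) z') in *. lra.
        + destruct (Hl w Hw ltac:(eauto)) as (w' & I & H).
          exists w'. split; [apply in_or_app; now right|assumption]. }
    exists l. intros w Hw. apply Hl; [assumption|]. apply Hzs.
    pose proof (HP w Hw). pose proof (d_tri o (ev w o) (ev w y)).
    rewrite <- !word_isomE in *. rewrite iso_d in *. lra.
Qed.

Context (Hdisc : discrete_subgroup d A (bw A) B (bw B)).

(** Two words that are eps/3-close on an eps/3-net of [K] differ by an element moving every point of
    [K] less than [eps]; discreteness at the identity makes it trivial. *)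
Lemma finite_bounded_displacement o C :
  exists l, forall w, d o (ev w o) <= C ->
    exists w', In w' l /\ forall x, ev w x = ev w' x.
Proof.
  destruct (Hdisc nil) as (K & eps & HK & He & Hd).
  destruct (HK X (fun z y => d z y < eps / 3)) as [ys Hys].
  - intros z y Hy. exists (eps / 3 - d z y). split; [lra|]. intros y' Hy'.
    pose proof (d_tri z y y'). lra.
  - intros y _. exists y. rewrite d_refl. lra.
  - destruct (finite_net_of_words ys (eps / 3) o C (fun w => d o (ev w o) <= C)
      ltac:(lra) ltac:(auto)) as [l Hl].
    exists l. intros w Hw. destruct (Hl w Hw) as (w' & I & _ & H).
    exists w'. split; [assumption|].
    assert (E : ext_eq (ev (inv_word w' ++ w)) (ev nil)).
    { apply Hd. intros x Hx. rewrite ev_app, ev_inv_word. cbn [eval_word].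
      rewrite d_sym, d_bw, word_isomE.
      destruct (Hys x Hx) as (z & Iz & Dz). specialize (H z Iz).
      pose proof (d_tri (ev w' x) (ev w' z) (ev w x)).
      pose proof (d_tri (ev w' z) (ev w z) (ev w x)).
      rewrite (d_sym (ev w' z) (ev w z)) in *.
      rewrite <- !word_isomE in *. rewrite !iso_d in *. rewrite (d_sym x z) in *. lra. }
    intro x. specialize (E x). rewrite ev_app, ev_inv_word in E. cbn [eval_word] in E.
    rewrite <- (fw_bw (word_isom w') (ev w x)), E. apply word_isomE.
Qed.

(** * Divergence of orbits without common powers *)

Lemma infinite_pigeonhole {W : Type} (l : list W) (Q : nat -> W -> Prop) :
  (forall N, exists n w, (N <= n)%nat /\ In w l /\ Q n w) ->
  exists w, forall N, exists n, (N <= n)%nat /\ Q n w.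
Proof.
  induction l as [|w l IH]; intro H.
  - destruct (H 0%nat) as (n & w & _ & [] & _).
  - destruct (classic (forall N, exists n, (N <= n)%nat /\ Q n w)) as [|N]; [now exists w|].
    apply not_all_ex_not in N as [N HN]. apply IH. intro N'.
    destruct (H (Nat.max N N')) as (n & w' & Hn & [<-|I] & Hq).
    + exfalso. apply HN. exists n. split; [lia|assumption].
    + exists n, w'. repeat split; [lia|assumption|assumption].
Qed.

(** The exponent [j] may be 0, so [u] has infinite order; the two clauses cover both signs of the
    exponent of [v]. *)
Definition no_common_power (u v : isom) : Prop := forall p j, (1 <= p)%nat ->
  ~ (forall x, pow u p x = pow v j x) /\ ~ (forall x, pow u p x = pow (inv v) j x).

(** Otherwise the elements v^-k u^n with unbounded n take finitely many values. Two coincide for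
    different n, which equates a positive power of [u] with a power of [v]. *)
Lemma orbits_diverge (u v : isom) o C :
  in_group u -> in_group v -> no_common_power u v ->
  exists N, forall n k, (N <= n)%nat -> C < d (pow u n o) (pow v k o).
Proof.
  intros Hu Hv NC. apply NNPP. intro H.
  destruct (finite_bounded_displacement o C) as [l Hl].
  destruct (infinite_pigeonhole l
    (fun n w => exists k, forall x, bw (pow v k) (pow u n x) = ev w x)) as [w Hw].
  - intro N. apply NNPP. intro H1. apply H. exists N. intros n k Hn.
    apply Rnot_le_lt. intro Hd. apply H1.
    destruct (in_group_comp _ _ (in_group_inv _ (in_group_pow v k Hv)) (in_group_pow u n Hu))
      as [w Ew].
    destruct (Hl w) as (w' & I & E).
    { rewrite <- Ew. cbn. rewrite d_bw, d_sym. exact Hd. }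
    exists n, w'. repeat split; try assumption. exists k. intro x. rewrite <- E, <- Ew.
    reflexivity.
  - destruct (Hw 0%nat) as (n1 & _ & k1 & E1).
    destruct (Hw (S n1)) as (n2 & Hn & k2 & E2).
    assert (E : forall y, pow u (n2 - n1) y = pow v k2 (bw (pow v k1) y)).
    { intro y. rewrite <- (fw_bw (pow u n1) y) at 1. rewrite <- pow_add.
      replace (n2 - n1 + n1)%nat with n2 by lia.
      apply (fw_inj (inv (pow v k2))). cbn. rewrite bw_fw, E2, <- E1, fw_bw. reflexivity. }
    destruct (NC (n2 - n1)%nat (Nat.max k1 k2 - Nat.min k1 k2)%nat ltac:(lia)) as [N1 N2].
    destruct (Nat.le_ge_cases k1 k2) as [L|L].
    + apply N1. intro y. rewrite E. rewrite <- (fw_bw (pow v k1) y) at 2.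
      rewrite <- pow_add. do 2 f_equal. lia.
    + apply N2. intro y. rewrite E, pow_inv. apply (fw_inj (pow v (Nat.max k1 k2 - Nat.min k1 k2))).
      rewrite fw_bw, <- pow_add. rewrite <- (fw_bw (pow v k1) y) at 2. do 2 f_equal. lia.
Qed.

Lemma orbits_gromov_diverge (u v : isom) lv o C :
  in_group u -> in_group v -> no_common_power u v ->
  transl_length d v lv -> 5 * delta < lv ->
  exists N, forall n k, (N <= n)%nat -> C < gromov d (pow u n o) o (pow v k o).
Proof.
  intros Hu Hv NC T P.
  destruct (orbits_diverge u v o (C + 2 * disp v o 1 + 4 * delta) Hu Hv NC) as [N HN].
  exists N. intros n k Hn.
  destruct (near_orbit v lv o (pow u n o) k T P) as [j Hj].
  specialize (HN n j Hn). lra.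
Qed.

(** * Integer powers, normalized elements and virtual cyclicity *)

Definition zi (g : isom) (p : Z) : isom :=
  match p with
  | Z0 => pow g 0
  | Zpos n => pow g (Pos.to_nat n)
  | Zneg n => pow (inv g) (Pos.to_nat n)
  end.

Lemma zi_nat g n x : zi g (Z.of_nat n) x = pow g n x.
Proof. destruct n as [|n]; [reflexivity|]. simpl. now rewrite SuccNat2Pos.id_succ. Qed.

Lemma zi_opp_nat g n x : zi g (- Z.of_nat n) x = pow (inv g) n x.
Proof. destruct n as [|n]; [reflexivity|]. simpl. now rewrite SuccNat2Pos.id_succ. Qed.

Lemma zi_succ g p x : zi g (Z.succ p) x = g (zi g p x).
Proof.
  destruct (Z_lt_le_dec p 0) as [L|L].
  - replace p with (- Z.of_nat (S (Z.abs_nat p - 1)))%Z at 2 by lia.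
    replace (Z.succ p) with (- Z.of_nat (Z.abs_nat p - 1))%Z by lia.
    rewrite !zi_opp_nat. cbn. now rewrite fw_bw.
  - replace p with (Z.of_nat (Z.abs_nat p)) by lia.
    rewrite <- Nat2Z.inj_succ, !zi_nat. reflexivity.
Qed.

Lemma zi_add g p q x : zi g (p + q) x = zi g p (zi g q x).
Proof.
  induction p as [|p IH|p IH] using Z.peano_ind; [reflexivity| |].
  - now rewrite Z.add_succ_l, !zi_succ, IH.
  - apply (fw_inj g). rewrite <- !zi_succ, <- Z.add_succ_l, Z.succ_pred. exact IH.
Qed.

Lemma near_minimum {I : Type} (i0 : I) (f : I -> R) :
  (forall i, 0 <= f i) -> exists i, forall j, f i <= f j + 1.
Proof.
  intro P. destruct (completeness (fun v => exists i, v = - f i)) as [m [M1 M2]].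
  - exists 0. intros v [i ->]. specialize (P i). lra.
  - now exists (- f i0), i0.
  - assert (exists i, m - 1 < - f i) as [i Hi].
    { apply NNPP. intro N. enough (m <= m - 1) by lra. apply M2. intros v [i ->].
      apply Rnot_lt_le. intro. apply N. now exists i. }
    exists i. intro j. pose proof (M1 (- f j) ltac:(now exists j)). lra.
Qed.

(* In a tree the displacement of a point determines its distance to the axis; here it
   bounds the distance to the orbit of [x]. *)
Lemma near_orbit_of_disp (g : isom) l x :
  transl_length d g l -> 5 * delta < l ->
  exists C, forall y, (forall k, disp g y k = disp g x k) ->
    exists n, d y (zi g n x) <= C.
Proof.
  intros T P. pose proof (delta_nonneg x) as D0.
  set (a := disp g x 1 + 2 * delta).
  (* [k] is so large that the product of g^k x and g^m x at [x] exceeds [c], and [m] so large that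
     s_m > 2 c + 2 delta. *)
  destruct (tl_unbounded g l x (a + 2 * delta + 1) 0 T ltac:(lra)) as (k & _ & Hk).
  set (c := (disp g x k + 1) / 2 + delta).
  destruct (tl_unbounded g l x (2 * c + 2 * delta) k T ltac:(lra)) as (m & Lm & Hm).
  exists (2 * c + delta). intros y Hy.
  (* After translation by a power of [g], [x] itself is almost a nearest orbit point; this bounds
     the products of y' with g^m x and g^-m x by [c]. *)
  destruct (near_minimum 0%Z (fun n => d y (zi g n x)) ltac:(intro; apply d_nonneg)) as [n Hn].
  exists n. set (y' := bw (zi g n) y).
  assert (E1 : forall p, d y' (zi g p x) = d y (zi g (n + p) x)).
  { intro p. unfold y'. rewrite d_sym, d_bw, d_sym. now rewrite zi_add. }
  assert (E2 : disp g y' m = disp g x m).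
  { rewrite <- Hy. unfold y'. rewrite <- (iso_d (zi g n)), fw_bw, <- !zi_nat.
    now rewrite <- zi_add, Z.add_comm, zi_add, fw_bw. }
  assert (E0 : d y (zi g n x) = d y' x).
  { rewrite <- (Z.add_0_r n) at 1. rewrite <- E1. reflexivity. }
  rewrite E0. cbv beta in Hn. rewrite E0 in Hn.
  assert (H : forall p, d y' x <= d y' (zi g p x) + 1) by (intro p; rewrite E1; apply Hn).
  clear E0 Hn E1 Hy. clearbody y'. clear y n.
  pose proof (disp_superadd g l x k (m - k) T P) as S.
  replace (k + (m - k))%nat with m in S by lia. fold a in S.
  assert (G1 : gromov d x y' (pow g m x) <= c).
  { pose proof (H (Z.of_nat k)) as Hp. rewrite zi_nat in Hp.
    destruct (gromov_ineq x y' (pow g m x) (pow g k x)) as [I|I];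
      unfold gromov in I; unfold gromov; rewrite ?(d_sym (pow g m x)), ?d_pow in I by lia;
      rewrite (d_sym y' x) in *; unfold c; unfold a in *; lra. }
  assert (G2 : gromov d x y' (pow (inv g) m x) <= c).
  { pose proof (H (- Z.of_nat k)%Z) as Hp. rewrite zi_opp_nat in Hp.
    rewrite <- !(d_pow_inv g) in S.
    destruct (gromov_ineq x y' (pow (inv g) m x) (pow (inv g) k x)) as [I|I];
      unfold gromov in I; unfold gromov;
      rewrite ?(d_sym (pow (inv g) m x)), ?d_pow in I by lia;
      rewrite (d_sym y' x), ?d_pow_inv in *; unfold c; unfold a in *; lra. }
  pose proof (gromov_shift (pow g m) x y') as G3.
  rewrite gromov_sym, <- pow_inv, (gromov_sym _ (pow (inv g) m x)) in G3.
  (* The path y', x, g^m x, g^m y' hardly backtracks, so g^m moves y' by about 2 d(x, y') + s_m. As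
     this displacement equals s_m, the distance d(x, y') is bounded. *)
  assert (G4 : gromov d x y' (pow g m y') <= c + delta).
  { destruct (gromov_ineq x y' (pow g m y') (pow g m x)); lra. }
  unfold gromov in G3, G4. rewrite (iso_d (pow g m)) in G3.
  unfold gromov in G2.
  rewrite (d_sym y' x) in *. lra.
Qed.

Definition normalizes (z g : isom) : Prop :=
  (forall x, g (z x) = z (g x)) \/ (forall x, g (z x) = bw z (g x)).

Lemma normalizes_bw z g :
  normalizes z g ->
  (forall x, g (z x) = z (g x) /\ g (bw z x) = bw z (g x)) \/
  (forall x, g (z x) = bw z (g x) /\ g (bw z x) = z (g x)).
Proof.
  intros [H|H]; [left|right]; intro x; split; try apply H.
  - apply (fw_inj z). now rewrite <- H, !fw_bw.
  - rewrite <- (fw_bw z x) at 2. now rewrite H, fw_bw.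
Qed.

Lemma normalizes_inv z g : normalizes z g -> normalizes z (inv g).
Proof.
  intros [H|H]%normalizes_bw; [left|right]; intro x; apply (fw_inj g); cbn.
  - now rewrite fw_bw, (proj1 (H _)), fw_bw.
  - now rewrite fw_bw, (proj2 (H _)), fw_bw.
Qed.

Lemma normalizes_comp z g h : normalizes z g -> normalizes z h -> normalizes z (comp g h).
Proof.
  intros [G|G]%normalizes_bw [H|H]%normalizes_bw; [left|right|right|left];
    intro x; cbn; destruct (H x) as [-> _]; apply G.
Qed.

Lemma normalizes_disp z g x k :
  normalizes z g -> disp z (bw g x) k = disp z x k.
Proof.
  intro N. rewrite <- (iso_d g), fw_bw.
  destruct N as [H|H].
  - replace (g (pow z k (bw g x))) with (pow z k x); [reflexivity|].
    induction k as [|k IH]; cbn; [now rewrite fw_bw|now rewrite H, IH].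
  - replace (g (pow z k (bw g x))) with (pow (inv z) k x); [apply d_pow_inv|].
    induction k as [|k IH]; cbn; [now rewrite fw_bw|now rewrite H, IH].
Qed.

Lemma normalizes_word z w :
  normalizes z A -> normalizes z B -> normalizes z (word_isom w).
Proof.
  intros HA HB. induction w as [|[[] []] w IH].
  - now left.
  - now apply normalizes_comp; [apply normalizes_inv|].
  - now apply normalizes_comp.
  - now apply normalizes_comp; [apply normalizes_inv|].
  - now apply normalizes_comp.
Qed.

(** Each w^-1 o has the same displacements under [z] as [o], hence lies within [C] of some z^n o.
    Then w z^n moves [o] by at most [C], and the finitely many such elements represent all
    cosets. *)
Lemma virtually_cyclic_of_normalizes z l (o : X) :
  in_group z -> transl_length d z l -> 5 * delta < l ->
  normalizes z A -> normalizes z B -> virtually_cyclic A (bw A) B (bw B).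
Proof.
  intros [c Hc] T P HA HB.
  destruct (near_orbit_of_disp z l o T P) as [C HC].
  destruct (finite_bounded_displacement o C) as [gs Hgs].
  assert (Ec : forall n x, ev (zpow_word c n) x = zi z n x).
  { intros [|n|n] x; [reflexivity| |]; cbn [zpow_word zi]; rewrite ev_rep_word; apply pow_ext;
      intro y; rewrite word_isomE; [now rewrite <- Hc|].
    rewrite ev_inv_word. apply (fw_inj z). cbn.
    now rewrite Hc, <- word_isomE, !fw_bw. }
  exists c, gs. intro w.
  destruct (HC (bw (word_isom w) o)) as [n Hn].
  { intro k. apply normalizes_disp. now apply normalizes_word. }
  destruct (Hgs (w ++ zpow_word c n)) as (g & I & E).
  { rewrite ev_app, Ec, <- word_isomE. now rewrite <- (iso_d (word_isom w)), fw_bw in Hn. }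
  exists g, (- n)%Z. split; [assumption|]. intro x.
  rewrite ev_app, <- E, ev_app, !Ec, <- zi_add, Z.add_opp_diag_r. reflexivity.
Qed.

End Group.

(** * Free semigroups *)

(** The pair [y1], [z1] places [x] far from w = g^n o. If [g] did not move [x] towards w, then [x]
    would be clearly farther from g^(n-1) o than from w, and the geodesics from w to [x] and to g^-n
    o would separate within about s_1 / 2. But both follow the one to [y] for longer. *)
Lemma toward_far_orbit (g : isom) l o n x y y1 z1 :
  transl_length d g l -> 13 * delta < l -> (1 <= n)%nat ->
  gromov d x y (pow g n o) <= 2 * delta -> gromov d x y1 z1 <= 2 * delta ->
  disp g o 1 + 4 * delta < gromov d (pow g n o) (pow (inv g) n o) y ->
  disp g o 1 + 4 * delta < gromov d (pow g n o) y1 z1 ->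
  4 * delta < gromov d x (g x) (pow g n o).
Proof.
  intros T P Hn Hy H1 Fy F1. apply Rnot_le_lt. intro K.
  pose proof (delta_nonneg o) as D0. pose proof (d_nonneg o (pow g 1 o)) as S0.
  destruct n as [|n]; [lia|].
  pose proof (tl_disp g l x T) as Lx.
  assert (E : d (g x) (pow g (S n) o) = d x (pow g n o)) by exact (iso_d g x (pow g n o)).
  pose proof (four_point x (pow (inv g) (S n) o) (pow g n o) (pow g (S n) o)) as F.
  rewrite !d_pow_opp in F. rewrite d_pow in F by lia.
  replace (S n - n)%nat with 1%nat in F by lia.
  replace (S n + S n)%nat with (S (S n + n)) in F by lia.
  pose proof (disp_step g l o (S n + n) T ltac:(lra)) as St.
  set (w := pow g (S n) o) in *. set (w' := pow (inv g) (S n) o) in *.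
  assert (Ew : d w w' = disp g o (S (S n + n))).
  { unfold w, w'. rewrite d_sym, d_pow_opp. do 3 f_equal. lia. }
  pose proof (gromov_lipschitz x w y1 z1) as Li.
  assert (G : gromov d w w' x < disp g o 1 / 2 - 3 / 2 * delta).
  { unfold gromov in *. rewrite Ew, (d_sym w x), (d_sym w' x). lra. }
  destruct (gromov_ineq w w' y x) as [I|I]; [lra|].
  rewrite (gromov_sym w y x), (gromov_swap w x y), (gromov_sym x w y), (d_sym w x) in I. lra.
Qed.

Lemma gromov_mixed x p q y z :
  gromov d x p q <= 2 * delta ->
  4 * delta < gromov d x y p -> 4 * delta < gromov d x z q ->
  gromov d x y z <= 4 * delta.
Proof.
  intros H Hy Hz. pose proof (delta_nonneg x).
  destruct (gromov_ineq x p y q) as [I|I]; rewrite ?(gromov_sym x p y) in I; [lra|].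
  destruct (gromov_ineq x y z q) as [J|J]; lra.
Qed.

(** The first letter of a positive word can be read off from the direction in which its orbit point
    leaves [x]; equal first letters cancel. *)
Lemma free_semigroup_criterion (u v : isom) x lu lv :
  transl_length d u lu -> transl_length d v lv ->
  13 * delta < lu -> 13 * delta < lv ->
  gromov d x (bw u x) (v x) <= 4 * delta ->
  gromov d x (bw v x) (u x) <= 4 * delta ->
  gromov d x (u x) (v x) <= 4 * delta ->
  free_semigroup u v.
Proof.
  intros Tu Tv Hu Hv Huv Hvu Hd. pose proof (delta_nonneg x) as D0.
  set (g := fun c : bool => if c then v else u).
  assert (Tg : forall c, exists l, transl_length d (g c) l /\ 13 * delta < l)
    by (intros []; eauto).
  (* [beta c] is the backtracking when a letter repeats; [disp_two] keeps it below half the step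
     length minus 11/2 delta. [gam] below also admits the 4 delta lost at a change of letter. *)
  set (beta := fun c => gromov d x (bw (g c) x) (g c x)).
  assert (Mix : forall c e, c <> e -> gromov d x (bw (g c) x) (g e x) <= 4 * delta)
    by (intros [] []; cbn; congruence).
  assert (Beta : forall c, 2 * beta c + 11 * delta < d x (g c x) /\ 0 <= beta c).
  { intro c. destruct (Tg c) as (l & T & Hl).
    pose proof (disp_two (g c) l x T ltac:(lra)) as H2.
    split; [|unfold beta; apply gromov_bounds]. unfold beta, gromov.
    rewrite d_bw, (d_sym (bw _ x)), d_bw, (d_sym (g c x) x), (d_sym (g c (g c x)) x).
    cbn in H2. lra. }
  assert (Len : forall c, 13 * delta < d x (g c x)).
  { intro c. destruct (Tg c) as (l & T & Hl). pose proof (tl_disp (g c) l x T). lra. }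
  set (gam := fun c => Rmax (4 * delta) (beta c)).
  assert (Gam : forall c, 4 * delta <= gam c /\ beta c <= gam c /\
    2 * gam c + 2 * delta < d x (g c x) /\ gam c + 6 * delta < d x (g c x)).
  { intro c. specialize (Beta c). specialize (Len c). unfold gam, Rmax.
    destruct Rle_dec; lra. }
  assert (Claim : forall w c, d x (g c x) - gam c - delta <=
    gromov d x (g c x) (eval_pos u v (c :: w) x)).
  { induction w as [|e w IH]; intro c; specialize (Gam c) as Gc.
    - replace (eval_pos u v (c :: nil) x) with (g c x) by now destruct c.
      rewrite gromov_diag. lra.
    - specialize (IH e). specialize (Gam e) as Ge.
      replace (eval_pos u v (c :: e :: w) x) with (g c (eval_pos u v (e :: w) x))
        by now destruct c.
      set (y := eval_pos u v (e :: w) x) in *.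
      rewrite gromov_shift. rewrite gromov_sym in IH.
      destruct (gromov_ineq x (bw (g c) x) y (g e x)) as [I|I].
      + assert (gromov d x (bw (g c) x) (g e x) <= gam c); [|lra].
        destruct (Bool.bool_dec c e) as [<-|N]; [apply Gc|].
        specialize (Mix c e N). lra.
      + destruct (Bool.bool_dec c e) as [<-|N].
        * change (gromov d x (bw (g c) x) (g c x)) with (beta c) in I. lra.
        * specialize (Mix c e N). lra. }
  assert (NonId : forall c w, eval_pos u v (c :: w) x <> x).
  { intros c w E. specialize (Claim w c). specialize (Gam c).
    rewrite E, gromov_base in Claim. lra. }
  assert (Inj : forall w1 w2, w1 <> w2 -> ~ ext_eq (eval_pos u v w1) (eval_pos u v w2)).
  { induction w1 as [|c1 w1 IH]; intros [|c2 w2] N E.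
    - congruence.
    - apply (NonId c2 w2). now rewrite <- E.
    - apply (NonId c1 w1). now rewrite E.
    - destruct (Bool.bool_dec c1 c2) as [<-|Hc].
      + apply (IH w2); [congruence|]. intro y. apply (fw_inj (g c1)).
        specialize (E y). destruct c1; exact E.
      + pose proof (Claim w1 c1) as C1. pose proof (Claim w2 c2) as C2.
        rewrite (E x) in C1. rewrite gromov_sym in C2.
        pose proof (Gam c1). pose proof (Gam c2).
        assert (gromov d x (g c1 x) (g c2 x) <= 4 * delta)
          by (destruct c1, c2; cbn; try congruence; rewrite gromov_sym; exact Hd).
        destruct (gromov_ineq x (g c1 x) (eval_pos u v (c2 :: w2) x) (g c2 x)); lra. }
  intros w1 w2 _ _. apply Inj.
Qed.

(* The points [pt l] lie far out on the axes of [u] and [v]; the last hypothesis says that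
   these axes are not oppositely oriented. The base point of the criterion is the place
   where the axis of [v] leaves that of [u] in the forward direction. *)
Lemma free_semigroup_of_orientation (u v : isom) lu lv o n C :
  let pt l := pow (letter_isom u v l) n o in
  transl_length d u lu -> transl_length d v lv ->
  13 * delta < lu -> 13 * delta < lv -> (1 <= n)%nat ->
  (forall l, disp (letter_isom u v l) o 1 + 4 * delta <= C) ->
  (forall l1 l2, l1 <> l2 -> C + delta < gromov d (pt l1) (pt l2) o) ->
  d (pt (Ga, true)) (pt (Gb, true)) + d (pt (Ga, false)) (pt (Gb, false)) <=
  d (pt (Ga, true)) (pt (Gb, false)) + d (pt (Ga, false)) (pt (Gb, true)) ->
  free_semigroup u v.
Proof.
  intros pt Tu Tv Hu Hv Hn HC Far Ori.
  pose proof (delta_nonneg o) as D0.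
  assert (Far3 : forall l1 l2 l3, l2 <> l1 -> l3 <> l1 ->
    C < gromov d (pt l1) (pt l2) (pt l3)).
  { intros l1 l2 l3 N2 N3.
    pose proof (Far l1 l2 ltac:(congruence)). pose proof (Far l1 l3 ltac:(congruence)) as F3.
    rewrite gromov_sym in F3.
    destruct (gromov_ineq (pt l1) (pt l2) o (pt l3)); lra. }
  destruct (tripod_center (pt (Ga, true)) (pt (Ga, false)) (pt (Gb, false)))
    as (x & Gpq & Gqs & Gps).
  (* For the far points p, q = u^-n o, u^n o and r, s = v^-n o, v^n o, the orientation hypothesis
     reads (p|s) + (r|q) <= (p|r) + (q|s) at [x]. Since (p|q) = 0, one of (p|r) and (r|q) is at most
     [delta]. *)
  assert (Grq : gromov d x (pt (Gb, true)) (pt (Ga, false)) <= 2 * delta).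
  { pose proof (proj1 (proj1 (gromov_bounds x (pt (Ga, true)) (pt (Gb, false))))).
    destruct (gromov_ineq x (pt (Ga, true)) (pt (Gb, true)) (pt (Ga, false))) as [I|I]; [|lra].
    unfold gromov in *. rewrite (d_sym (pt (Gb, true)) (pt (Ga, false))). lra. }
  (* A letter moves [x] towards its own far point. *)
  assert (Toward : forall l y y1 z1, y <> l -> y <> inv_letter l -> y1 <> l -> z1 <> l ->
    gromov d x (pt y) (pt l) <= 2 * delta -> gromov d x (pt y1) (pt z1) <= 2 * delta ->
    4 * delta < gromov d x (letter_isom u v l x) (pt l)).
  { intros l y y1 z1 N1 N2 N3 N4 H1 H2.
    assert (exists ll, transl_length d (letter_isom u v l) ll /\ 13 * delta < ll)
      as (ll & Tl & Hl).
    { destruct l as [[] []]; eexists; split; eauto using tl_inv. }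
    apply (toward_far_orbit _ ll o n x (pt y) (pt y1) (pt z1) Tl Hl Hn H1 H2).
    - rewrite pow_inv, <- pow_letter_inv. specialize (HC l).
      pose proof (Far3 l (inv_letter l) y ltac:(now destruct l as [[] []]) N1) as F.
      fold (pt l). fold (pt (inv_letter l)). lra.
    - specialize (HC l). pose proof (Far3 l y1 z1 N3 N4). fold (pt l). lra. }
  apply (free_semigroup_criterion u v x lu lv Tu Tv Hu Hv).
  - apply (gromov_mixed x (pt (Ga, true)) (pt (Gb, false))); [lra| |].
    + apply (Toward (Ga, true) (Gb, false) (Ga, false) (Gb, false));
        try discriminate; rewrite ?(gromov_sym x (pt (Gb, false))); lra.
    + apply (Toward (Gb, false) (Ga, true) (Ga, true) (Ga, false)); try discriminate; lra.
  - apply (gromov_mixed x (pt (Gb, true)) (pt (Ga, false))); [lra| |].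
    + apply (Toward (Gb, true) (Ga, false) (Ga, true) (Ga, false));
        try discriminate; rewrite ?(gromov_sym x (pt (Ga, false)) (pt (Gb, true))); lra.
    + apply (Toward (Ga, false) (Gb, false) (Ga, true) (Gb, false));
        try discriminate; rewrite ?(gromov_sym x (pt (Gb, false))); lra.
  - apply (gromov_mixed x (pt (Ga, false)) (pt (Gb, false))); [lra| |].
    + apply (Toward (Ga, false) (Gb, false) (Ga, true) (Gb, false));
        try discriminate; rewrite ?(gromov_sym x (pt (Gb, false))); lra.
    + apply (Toward (Gb, false) (Ga, true) (Ga, true) (Ga, false)); try discriminate; lra.
Qed.

(** * Free semigroups from elements without common powers *)

Lemma tl_letter (u v : isom) lu lv l :
  transl_length d u lu -> transl_length d v lv ->
  transl_length d (letter_isom u v l) (match fst l with Ga => lu | Gb => lv end).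
Proof. intros Tu Tv. destruct l as [[] []]; (assumption || now apply tl_inv). Qed.

Lemma eventually_all_letters (Q : nat -> letter -> Prop) :
  (forall l, exists N, forall n, (N <= n)%nat -> Q n l) ->
  exists N, forall n l, (N <= n)%nat -> Q n l.
Proof.
  intro H.
  destruct (H (Ga, true)) as [N1 H1], (H (Ga, false)) as [N2 H2],
    (H (Gb, true)) as [N3 H3], (H (Gb, false)) as [N4 H4].
  exists (Nat.max (Nat.max N1 N2) (Nat.max N3 N4)). intros n [[] []] Hn.
  - apply H1; lia.
  - apply H2; lia.
  - apply H3; lia.
  - apply H4; lia.
Qed.

Lemma opposite_ends_diverge (g : isom) l o C :
  transl_length d g l -> 4 * delta < l ->
  exists N, forall n, (N <= n)%nat -> C < gromov d (pow (inv g) n o) (pow g n o) o.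
Proof.
  intros T P. destruct (INR_unbounded (C / (l - 4 * delta))) as [N HN].
  exists N. intros n Hn.
  replace (gromov d (pow (inv g) n o) (pow g n o) o) with (disp g o (n + n) / 2).
  - pose proof (disp_lower g l o (n + n) T P) as D. rewrite plus_INR in D.
    assert (INR N <= INR n) by now apply le_INR.
    assert (C / (l - 4 * delta) < INR n) as Q by lra.
    apply (Rmult_lt_compat_r (l - 4 * delta)) in Q; [|lra].
    unfold Rdiv in Q. rewrite Rmult_assoc, Rinv_l, Rmult_1_r in Q by lra. lra.
  - unfold gromov. rewrite d_pow_opp, (d_sym _ o), d_pow_inv, (d_sym _ o). lra.
Qed.

Lemma no_common_power_inv_r (u v : isom) :
  no_common_power u v -> no_common_power u (inv v).
Proof.
  intros H p j Hp. destruct (H p j Hp) as [H1 H2]. split; intro E; [now apply H2|].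
  apply H1. intro x. rewrite E. now apply pow_ext.
Qed.

Lemma no_common_power_inv_l (u v : isom) :
  no_common_power u v -> no_common_power (inv u) v.
Proof.
  intros H p j Hp. destruct (H p j Hp) as [H1 H2].
  split; intro E; [apply H2|apply H1]; intro x; specialize (E (pow u p x));
    rewrite !pow_inv, bw_fw in E.
  - apply (fw_inj (pow v j)). rewrite pow_inv, fw_bw. congruence.
  - rewrite E at 2. now rewrite fw_bw.
Qed.

Lemma no_common_power_sym (u v : isom) lv (o : X) :
  transl_length d v lv -> 0 < lv -> no_common_power u v -> no_common_power v u.
Proof.
  intros T P H p j Hp.
  assert (j = 0%nat \/ (1 <= j)%nat) as [->|Hj] by lia.
  - pose proof (disp_pos v lv p o T P Hp) as D.
    split; intro E; rewrite (E o) in D; cbn in D; rewrite d_refl in D; lra.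
  - destruct (H j p Hj) as [H1 _].
    destruct (no_common_power_inv_l u v H j p Hj) as [H2 _].
    split; intro E; [now apply H1|now apply H2].
Qed.

Lemma free_semigroup_of_no_common_power (A B u v : isom) lu lv (o : X) :
  discrete_subgroup d A (bw A) B (bw B) ->
  in_group A B u -> in_group A B v -> no_common_power u v ->
  transl_length d u lu -> transl_length d v lv ->
  13 * delta < lu -> 13 * delta < lv ->
  free_semigroup u v \/ free_semigroup u (bw v).
Proof.
  intros Hd Iu Iv NC Tu Tv Hu Hv. pose proof (delta_nonneg o) as D0.
  set (C := disp u o 1 + disp v o 1 + 4 * delta).
  set (pt := fun n l => pow (letter_isom u v l) n o).
  assert (Far : exists N, forall n l1, (N <= n)%nat -> forall l2, l1 <> l2 ->
    C + delta < gromov d (pt n l1) (pt n l2) o).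
  { apply eventually_all_letters. intro l1.
    enough (exists N, forall n l2, (N <= n)%nat -> l1 <> l2 ->
      C + delta < gromov d (pt n l1) (pt n l2) o) as [N HN] by (exists N; auto).
    apply eventually_all_letters. intro l2.
    pose proof (tl_letter u v lu lv l1 Tu Tv) as T1.
    pose proof (tl_letter u v lu lv l2 Tu Tv) as T2.
    assert (In : forall l, in_group A B (letter_isom u v l))
      by (intros [[] []]; cbn; auto using in_group_inv).
    assert (fst l1 <> fst l2 \/ l1 = l2 \/ l1 = inv_letter l2) as [N|[->| ->]].
    { destruct l1 as [[] []], l2 as [[] []]; cbn;
        first [now right; left|now right; right|left; discriminate]. }
    - assert (NCl : no_common_power (letter_isom u v l1) (letter_isom u v l2)).
      { pose proof (no_common_power_sym u v lv o Tv ltac:(lra) NC).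
        destruct l1 as [[] []], l2 as [[] []]; cbn in N |- *; try (now destruct N);
          auto using no_common_power_inv_l, no_common_power_inv_r. }
      destruct (orbits_gromov_diverge A B Hd _ _ _ o (C + delta) (In l1) (In l2) NCl T2)
        as [M HM]; [destruct (fst l2); lra|].
      exists M. intros n Hn _. rewrite gromov_sym. now apply HM.
    - exists 0%nat. congruence.
    - destruct (opposite_ends_diverge (letter_isom u v l2) _ o (C + delta) T2) as [M HM].
      { destruct (fst l2); lra. }
      exists M. intros n Hn _. specialize (HM n Hn).
      rewrite pow_inv, <- pow_letter_inv in HM. exact HM. }
  destruct Far as [N HN]. set (n := S N).
  assert (Far : forall l1 l2, l1 <> l2 -> C + delta < gromov d (pt n l1) (pt n l2) o)
    by (intros l1 l2; apply HN; lia).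
  clear HN.
  assert (HC : forall l, disp (letter_isom u v l) o 1 + 4 * delta <= C).
  { intro l. rewrite disp_letter. pose proof (d_nonneg o (pow u 1 o)).
    pose proof (d_nonneg o (pow v 1 o)). unfold C. destruct (fst l); lra. }
  (* Either [u] and [v] satisfy the orientation condition, or [u] and [inv v] do; replacing [v] by
     its inverse exchanges the two far points of [v]. *)
  destruct (Rle_or_lt
    (d (pt n (Ga, true)) (pt n (Gb, true)) + d (pt n (Ga, false)) (pt n (Gb, false)))
    (d (pt n (Ga, true)) (pt n (Gb, false)) + d (pt n (Ga, false)) (pt n (Gb, true))))
    as [L|L].
  - left. apply (free_semigroup_of_orientation u v lu lv o n C); auto. lia.
  - right. change (bw v) with (fw (inv v)).
    set (flip := fun l : letter => match l with (Ga, s) => (Ga, s) | (Gb, s) => (Gb, negb s) end).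
    assert (Ept : forall l, pow (letter_isom u (inv v) l) n o = pt n (flip l)).
    { intros [[] []]; try reflexivity. now apply pow_ext. }
    apply (free_semigroup_of_orientation u (inv v) lu lv o n C); auto using tl_inv.
    + lia.
    + intro l. specialize (HC l). rewrite disp_letter in *.
      destruct (fst l); rewrite ?d_pow_inv; exact HC.
    + intros l1 l2 Hl. rewrite !Ept. apply Far.
      destruct l1 as [[] []], l2 as [[] []]; cbn; congruence.
    + rewrite !Ept. cbn [flip negb]. lra.
Qed.

(** * Conjugate elements and their common powers *)

Lemma normalizes_pow_self (g : isom) n : normalizes (pow g n) g.
Proof. left. intro x. apply (pow_comm g 1 n). Qed.

Lemma normalizes_ext (z z' g : isom) :
  (forall x, z x = z' x) -> normalizes z' g -> normalizes z g.
Proof.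
  intros E [H|H]; [left|right]; intro x; rewrite !E; [apply H|].
  apply (fw_inj z). now rewrite fw_bw, E, H, fw_bw.
Qed.

Lemma normalizes_pow_inv_self (g : isom) n : normalizes (pow (inv g) n) g.
Proof.
  left. intro x. rewrite !pow_inv. apply (fw_inj (pow g n)). rewrite fw_bw.
  change (pow g n (pow g 1 (bw (pow g n) x)) = g x). now rewrite pow_comm, fw_bw.
Qed.

Lemma pow_conj (g h : isom) n x :
  pow (comp g (comp h (inv g))) n x = g (pow h n (bw g x)).
Proof. induction n as [|n IH]; cbn; [now rewrite fw_bw|now rewrite IH, bw_fw]. Qed.

Lemma tl_conj (g h : isom) l :
  transl_length d h l -> transl_length d (comp g (comp h (inv g))) l.
Proof.
  intros T x. apply (Un_cv_ext (fun n => d (bw g x) (Nat.iter (S n) h (bw g x)) / INR (S n)));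
    [|apply T].
  intro n. now rewrite <- !pow_iter, pow_conj, <- (iso_d g), fw_bw.
Qed.

Lemma tl_pow_eq (g h : isom) l p j (o : X) :
  transl_length d g l -> transl_length d h l -> 0 < l -> (1 <= p)%nat ->
  (forall x, pow g p x = pow h j x) -> j = p.
Proof.
  intros Tg Th P Hp E.
  assert (j = 0%nat \/ (1 <= j)%nat) as [->|Hj] by lia.
  - pose proof (disp_pos g l p o Tg P Hp) as D. rewrite E in D. cbn in D.
    rewrite d_refl in D. lra.
  - pose proof (tl_pow h l j Th Hj o) as T1. pose proof (tl_pow g l p Tg Hp o) as T2.
    apply INR_eq. apply (Rmult_eq_reg_r l); [|lra].
    refine (UL_sequence _ _ _ T1 _).
    refine (Un_cv_ext _ _ _ _ T2). intro n. f_equal. f_equal.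
    rewrite <- !pow_iter. now apply pow_ext.
Qed.

(** Conjugate elements have equal translation lengths, so in a common power the exponents agree up
    to sign; hence g h^p g^-1 is h^p or h^-p. *)
Lemma conj_no_common_power (g h : isom) l (o : X) :
  transl_length d h l -> 0 < l ->
  (forall p, (1 <= p)%nat -> ~ normalizes (pow h p) g) ->
  no_common_power h (comp g (comp h (inv g))).
Proof.
  intros T P N p j Hp. split; intro E.
  - assert (j = p) as ->
      by exact (tl_pow_eq _ _ l p j o T (tl_conj g h l T) P Hp E).
    apply (N p Hp). left. intro x. now rewrite (E (g x)), pow_conj, bw_fw.
  - assert (j = p) as ->
      by exact (tl_pow_eq _ _ l p j o T (tl_inv _ _ (tl_conj g h l T)) P Hp E).
    apply (N p Hp). right. intro x. apply (fw_inj (pow h p)). rewrite fw_bw, (E (g _)), pow_inv.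
    apply (fw_inj (pow (comp g (comp h (inv g))) p)).
    now rewrite fw_bw, pow_conj, bw_fw.
Qed.

End Hyperbolic.

Theorem theorem6p9 (X : Type) (d : X -> X -> R) (delta : R)
  (a ainv b binv : X -> X) (la lb L : R) :
  hyperbolic_space d delta ->
  isometry_with_inv d a ainv -> isometry_with_inv d b binv ->
  transl_length d a la -> transl_length d b lb ->
  0 < la -> 0 < lb ->
  discrete_subgroup d a ainv b binv ->
  ~ virtually_cyclic a ainv b binv ->
  margulis_const d a ainv b binv L ->
  L > 23 * delta ->
  (la <= 13 * delta -> lb <= 13 * delta -> free_group_on a ainv b binv) /\
  (la > 13 * delta -> lb > 13 * delta ->
     free_semigroup a b \/ free_semigroup a binv) /\
  (la <= 13 * delta -> lb > 13 * delta ->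
     free_semigroup b (fun x => a (b (ainv x))) \/
     free_semigroup b (fun x => a (binv (ainv x)))) /\
  (la > 13 * delta -> lb <= 13 * delta ->
     free_semigroup a (fun x => b (a (binv x))) \/
     free_semigroup a (fun x => b (ainv (binv x)))).
Proof.
  intros HX Ia Ib Ta Tb Pa Pb Hd NVC HM HL.
  set (A := Isom d a ainv Ia). set (B := Isom d b binv Ib).
  assert (exists o : X, True) as [o _].
  { destruct (margulis_near d delta HX A B L HM 1 Rlt_0_1) as (x & _). now exists x. }
  pose proof (delta_nonneg d delta HX o) as D0.
  (* A positive power of [a] commutes with [a]; if [b] normalized it too, its translation length,
     above 5 delta, would make the group virtually cyclic. *)
  assert (NNa : forall p, la > 13 * delta -> (1 <= p)%nat -> ~ normalizes d (pow d A p) B).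
  { intros p Hl Hp N. apply NVC.
    pose proof (le_INR 1 p Hp) as Hp1. simpl in Hp1.
    apply (virtually_cyclic_of_normalizes d delta HX A B Hd (pow d A p) (INR p * la) o);
      [apply in_group_pow, in_group_A|now apply tl_pow|nra|apply normalizes_pow_self|exact N]. }
  assert (NNb : forall p, lb > 13 * delta -> (1 <= p)%nat -> ~ normalizes d (pow d B p) A).
  { intros p Hl Hp N. apply NVC.
    pose proof (le_INR 1 p Hp) as Hp1. simpl in Hp1.
    apply (virtually_cyclic_of_normalizes d delta HX A B Hd (pow d B p) (INR p * lb) o);
      [apply in_group_pow, in_group_B|now apply tl_pow|nra|exact N|apply normalizes_pow_self]. }
  repeat split.
  - intros Ha Hb. exact (free_of_margulis d delta HX A B la lb L Ta Tb Pa Pb HM Ha Hb HL).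
  - intros Ha Hb.
    apply (free_semigroup_of_no_common_power d delta HX A B A B la lb o Hd);
      auto using in_group_A, in_group_B.
    (* A power of [a] that is also a power of [b] commutes with [b]. *)
    intros p j Hp. split; intro E; apply (NNa p Ha Hp); eapply normalizes_ext; try exact E.
    + apply normalizes_pow_self.
    + apply normalizes_pow_inv_self.
  - intros Ha Hb.
    apply (free_semigroup_of_no_common_power d delta HX A B B
             (comp d A (comp d B (inv d A))) lb lb o Hd);
      auto using in_group_A, in_group_B, in_group_comp, in_group_inv, tl_conj.
    apply (conj_no_common_power d delta HX A B lb o); auto.
  - intros Ha Hb.
    apply (free_semigroup_of_no_common_power d delta HX A B A
             (comp d B (comp d A (inv d B))) la la o Hd);
      auto using in_group_A, in_group_B, in_group_comp, in_group_inv, tl_conj.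
    apply (conj_no_common_power d delta HX B A la o); auto.
Qed.
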